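(* A star extendible isomorphism between odd generic direct systems of 4-cycle algebras, or between generic direct systems of 4-cycle algebras with nonzero $H_1$ invariant, is necessarily a regular isomorphism.
   Context: 4-cycle algebras. For positive integers $n_1,\dots,n_4$ with $r=\sum n_i$, the 4-cycle algebra with these block sizes is the algebra $A\subseteq M_r(\mathbb C)$ of block matrices $(a_{ij})$, $a_{ij}\in M_{n_i,n_j}(\mathbb C)$, with $a_{ij}=0$ unless $i=j$ or ($i\in\{1,2\}$, $j\in\{3,4\}$). $Q_1,\dots,Q_4$ denote the block projections. $C^*(A)=M_r(\mathbb C)$. An embedding (injective homomorphism) $\phi:A\to A'$ is star extendible if it extends to a $*$-homomorphism $C^*(A)\to C^*(A')$; its multiplicity is that of the extension. It is regular if it is a direct sum (sum with mutually orthogonal ranges) of multiplicity one star extendible embeddings. A multiplicity one star extendible embedding is rigid of type $\theta$ if $\theta$ is a permutation of $\{1,2,3,4\}$ preserving $\{1,2\}$ and $\{3,4\}$ and $\phi(Q_iAQ_j)\subseteq Q'_{\theta(i)}A'Q'_{\theta(j)}$ for all $i,j$ (four types: $\mathrm{id},(12),(34),(12)(34)$). A rigid embedding is a sum of multiplicity one rigid embeddings with mutually orthogonal ranges; it is generic if all four types occur. $H_1$ of a 4-cycle algebra is $\mathbb Z$, and for $\phi$ rigid $H_1(\phi)$ is multiplication by (number of summands of type $\mathrm{id}$ or $(12)(34)$) minus (number of type $(12)$ or $(34)$). A generic system is a direct system $(A_k,\alpha_k)$ of 4-cycle algebras with all $\alpha_k$ generic; it is odd if only finitely many $\alpha_k$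 have even multiplicity. Its $H_1$ invariant is $\varinjlim(H_1(A_k),H_1(\alpha_k))$. A star extendible isomorphism between systems $(A_k,\alpha_k)$ and $(A'_k,\alpha'_k)$ is a commuting diagram of star extendible crossover embeddings $A_{n_1}\to A'_{m_1}\to A_{n_2}\to A'_{m_2}\to\cdots$ in which the composition of two consecutive crossover maps is the given embedding $A_{n_i}\to A_{n_{i+1}}$ or $A'_{m_i}\to A'_{m_{i+1}}$. It is a regular isomorphism if the crossover maps are regular, after passing if necessary to a subdiagram (composing the crossover maps with the given embeddings), so that the induced isomorphism of the limits is implemented by regular embeddings. *)

(* Defs.v *)
From HB Require Import structures.
From mathcomp Require Import all_boot all_order all_algebra all_fingroup.
From mathcomp Require Import generic_quotient spectral complex.
From mathcomp Require Import all_classical all_reals.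

Set Implicit Arguments.
Unset Strict Implicit.
Unset Printing Implicit Defensive.

Import Order.TTheory GRing.Theory Num.Theory.
Local Open Scope ring_scope.
Local Open Scope sesquilinear_scope.

(** Block indices 1, 2, 3, 4 are 0, 1, 2, 3 : 'I_4, so {1,2} is [i < 2].  The
    complex numbers are [R[i]] for [R : realType], and [M ^t*] is the conjugate
    transpose. *)

Record fcblocks := FCBlocks {
  bsize :> 'I_4 -> nat;
  bsize_gt0 : forall i, (0 < bsize i)%N
}.

(** The ambient full matrix algebra, which is also C*(A). *)
Notation fcmat R A := ('M[R[i]]_(\sum_(i < 4) bsize A i)) (only parsing).

Definition fcsupp (i j : 'I_4) : bool :=
  (i == j) || ((i < 2)%N && (2 <= j)%N).

Definition fcpred (R : realType) (A : fcblocks) : {pred fcmat R A} :=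
  fun a => [forall i, [forall j, ~~ fcsupp i j ==> (submxblock a i j == 0)]].
Arguments fcpred : clear implicits.

Lemma fcpredP (R : realType) (A : fcblocks) (a : fcmat R A) :
  reflect (forall i j, ~~ fcsupp i j -> submxblock a i j = 0) (a \in fcpred R A).
Proof.
apply: (iffP idP) => [/forallP H i j nij | H].
  by have /forallP/(_ j)/implyP/(_ nij)/eqP := H i.
by apply/forallP => i; apply/forallP => j; apply/implyP => /H ->.
Qed.

Lemma submxblockZ_fc (R : realType) (A : fcblocks) c (a : fcmat R A) i j :
  submxblock (c *: a) i j = c *: submxblock a i j.
Proof. by apply/matrixP => x y; rewrite !mxE. Qed.

Lemma submxblockM_fc (R : realType) (A : fcblocks) (a b : fcmat R A) i j :
  submxblock (a *m b) i j = \sum_k submxblock a i k *m submxblock b k j.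
Proof. by rewrite -{1}(submxblockK a) -{1}(submxblockK b) mul_mxblock mxblockK. Qed.

Lemma fcpred_mxdiag (R : realType) (A : fcblocks) (d : forall i, 'M[R[i]]_(A i)) :
  \mxdiag_i d i \in fcpred R A.
Proof.
apply/fcpredP => i j; rewrite negb_or => /andP [nij _].
by rewrite mxblockK (negPf nij).
Qed.

Lemma fcpred_subring_closed (R : realType) (A : fcblocks) :
  subring_closed (fcpred R A).
Proof.
split=> [|a b /fcpredP ha /fcpredP hb|a b /fcpredP ha /fcpredP hb].
- have -> : (1 : fcmat R A) = \mxdiag_i (1%:M : 'M[R[i]]_(A i)) by rewrite mxdiagZ.
  exact: fcpred_mxdiag.
- by apply/fcpredP => i j nij; rewrite submxblockB ha // hb // subr0.
apply/fcpredP => i j nij; rewrite submxblockM_fc big1 // => k _.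
have [ik|nik] := boolP (fcsupp i k); last by rewrite ha // mul0mx.
rewrite hb ?mulmx0 //; apply: contra nij => kj.
move: ik kj; rewrite /fcsupp => /predU1P [-> //|/andP [i2 k2]].
by case/predU1P => [<-|/andP []]; [rewrite i2 k2 orbT | rewrite ltnNge k2].
Qed.

Lemma fcpred_scaler_closed (R : realType) (A : fcblocks) :
  scaler_closed (fcpred R A).
Proof.
move=> c a /fcpredP ha; apply/fcpredP => i j nij.
by rewrite submxblockZ_fc ha // scaler0.
Qed.

HB.instance Definition _ (R : realType) (A : fcblocks) :=
  GRing.isSubringClosed.Build _ (fcpred R A) (@fcpred_subring_closed R A).
HB.instance Definition _ (R : realType) (A : fcblocks) :=
  GRing.isScaleClosed.Build _ _ (fcpred R A) (@fcpred_scaler_closed R A).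

(** The 4-cycle algebra with block sizes [A]. *)
Record fcalg (R : realType) (A : fcblocks) := FCAlg {
  fcval : fcmat R A;
  _ : fcval \in fcpred R A
}.

HB.instance Definition _ (R : realType) (A : fcblocks) :=
  [isSub for @fcval R A].
HB.instance Definition _ (R : realType) (A : fcblocks) :=
  [Choice of fcalg R A by <:].
HB.instance Definition _ (R : realType) (A : fcblocks) :=
  GRing.SubChoice_isSubPzRing.Build _ _ (fcalg R A) (@fcpred_subring_closed R A).
HB.instance Definition _ (R : realType) (A : fcblocks) :=
  [SubZmodule_isSubLmodule of fcalg R A by <:].

(** The block projection Q_i. *)
Definition blockproj (R : realType) (A : fcblocks) (i : 'I_4) : fcalg R A :=
  FCAlg (fcpred_mxdiag (fun k => ((k == i)%:R)%:M)).
Arguments blockproj : clear implicits.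

(** Homomorphisms of algebras are not required to be unital. *)
Definition embedding (R : realType) (A B : fcblocks) (f : fcalg R A -> fcalg R B) :=
  [/\ linear f, {morph f : x y / x * y} & injective f].

Definition star_hom (R : realType) (A B : fcblocks) (F : fcmat R A -> fcmat R B) :=
  [/\ linear F, {morph F : x y / x *m y} & forall x, F (x ^t*) = (F x) ^t*].

Definition star_extension (R : realType) (A B : fcblocks)
    (f : fcalg R A -> fcalg R B) (F : fcmat R A -> fcmat R B) :=
  star_hom F /\ forall a, F (fcval a) = fcval (f a).

Definition star_extendible (R : realType) (A B : fcblocks)
    (f : fcalg R A -> fcalg R B) :=
  embedding f /\ exists F, star_extension f F.

(** [F] is unitarily equivalent to x |-> x (+) ... (+) x (+) 0 with [m] copies
    of x; the [V k] are the first [m] block columns of the unitary. *)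
Definition star_multiplicity (R : realType) (A B : fcblocks)
    (F : fcmat R A -> fcmat R B) (m : nat) :=
  exists V : 'I_m -> 'M[R[i]]_(\sum_(i < 4) bsize B i, \sum_(i < 4) bsize A i),
    (forall k l, (V k) ^t* *m V l = ((k == l)%:R)%:M) /\
    (forall x, F x = \sum_k V k *m x *m (V k) ^t*).

Definition multiplicity (R : realType) (A B : fcblocks)
    (f : fcalg R A -> fcalg R B) (m : nat) :=
  exists F, star_extension f F /\ star_multiplicity F m.

Definition mult_one (R : realType) (A B : fcblocks) (f : fcalg R A -> fcalg R B) :=
  star_extendible f /\ multiplicity f 1.

Definition orthogonal_sum (R : realType) (A B : fcblocks) (N : nat)
    (psi : 'I_N -> fcalg R A -> fcalg R B) (f : fcalg R A -> fcalg R B) :=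
  (forall k l a b, k != l -> psi k a * psi l b = 0) /\
  (forall a, f a = \sum_k psi k a).

Definition regular (R : realType) (A B : fcblocks) (f : fcalg R A -> fcalg R B) :=
  star_extendible f /\
  exists N (psi : 'I_N -> fcalg R A -> fcalg R B),
    (forall k, mult_one (psi k)) /\ orthogonal_sum psi f.

Definition fctype (theta : 'S_4) :=
  forall i : 'I_4, (theta i < 2)%N = (i < 2)%N.

Definition rigid_of_type (R : realType) (A B : fcblocks) (theta : 'S_4)
    (f : fcalg R A -> fcalg R B) :=
  [/\ mult_one f, fctype theta &
      forall i j a, exists b,
        f (blockproj R A i * a * blockproj R A j) =
        blockproj R B (theta i) * b * blockproj R B (theta j)].

Definition rigid_sum (R : realType) (A B : fcblocks) (N : nat)
    (theta : 'I_N -> 'S_4) (psi : 'I_N -> fcalg R A -> fcalg R B)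
    (f : fcalg R A -> fcalg R B) :=
  (forall k, rigid_of_type (theta k) (psi k)) /\ orthogonal_sum psi f.

Definition generic (R : realType) (A B : fcblocks) (f : fcalg R A -> fcalg R B) :=
  star_extendible f /\
  exists N (theta : 'I_N -> 'S_4) (psi : 'I_N -> fcalg R A -> fcalg R B),
    rigid_sum theta psi f /\
    forall t, fctype t -> exists k, theta k = t.

Definition t12 : 'S_4 := tperm 0 1.
Definition t34 : 'S_4 := tperm 2 3.

Definition H1_spec (R : realType) (A B : fcblocks) (f : fcalg R A -> fcalg R B) :
    set int :=
  fun z => exists N (theta : 'I_N -> 'S_4) (psi : 'I_N -> fcalg R A -> fcalg R B),
    rigid_sum theta psi f /\
    z = #|[set k | theta k \in [:: 1%g; (t12 * t34)%g]]|%:Z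
        - #|[set k | theta k \in [:: t12; t34]]|%:Z.

(** The integer by which H_1(f) : Z -> Z multiplies.  The number of summands of
    each type does not depend on the decomposition of [f], so [H1_spec f] has
    exactly one element when [f] is rigid: type theta contributes a rank one part
    to Q'_(theta i) f(e) Q'_(theta j), for e of rank one in Q_i A Q_j, and the
    pairs (theta i, theta j), i in {1,2}, j in {3,4}, determine theta. *)
Definition H1 (R : realType) (A B : fcblocks) (f : fcalg R A -> fcalg R B) : int :=
  xget 0 (H1_spec f).

(** The direct limit of Z -> Z -> ..., the k-th map being multiplication by
    [d k].  A pair [(k, z)] stands for the image in the limit of the element z
    of the k-th group. *)
Section DirectLimit.
Variable d : nat -> int.

Definition push (x : nat * int) (m : nat) : int :=
  x.2 * \prod_(x.1 <= i < m) d i.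

Definition dl_rel (x y : nat * int) : bool :=
  `[< exists m, [/\ (x.1 <= m)%N, (y.1 <= m)%N & push x m = push y m] >].

Lemma pushD x m p : (x.1 <= m <= p)%N ->
  push x p = push x m * \prod_(m <= i < p) d i.
Proof.
by case/andP=> xm mp; rewrite /push -mulrA -big_cat_nat.
Qed.

Lemma dl_rel_refl : reflexive dl_rel.
Proof. by move=> x; apply/asboolP; exists x.1. Qed.

Lemma dl_rel_sym : symmetric dl_rel.
Proof. by move=> x y; apply/asboolP/asboolP => -[m [? ? ?]]; exists m. Qed.

Lemma dl_rel_trans : transitive dl_rel.
Proof.
move=> y x z /asboolP [m [xm ym e1]] /asboolP [p [yp zp e2]].
apply/asboolP; exists (maxn m p); split.
- by rewrite (leq_trans xm) ?leq_maxl.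
- by rewrite (leq_trans zp) ?leq_maxr.
rewrite (@pushD x m) ?xm ?leq_maxl // e1 -(@pushD y m) ?ym ?leq_maxl //.
by rewrite (@pushD y p) ?yp ?leq_maxr // e2 -(@pushD z p) ?zp ?leq_maxr.
Qed.

Canonical dl_equiv := EquivRel dl_rel dl_rel_refl dl_rel_sym dl_rel_trans.

Local Open Scope quotient_scope.

Definition dirlim : Type := {eq_quot dl_rel}.
HB.instance Definition _ := Choice.on dirlim.
HB.instance Definition _ := EqQuotient.on dirlim.

Definition dl_in (x : nat * int) : dirlim := \pi_dirlim x.

Lemma dl_inP x y :
  (exists m, [/\ (x.1 <= m)%N, (y.1 <= m)%N & push x m = push y m])
  <-> dl_in x = dl_in y.
Proof.
split=> [h|/eqP]; last by rewrite /dl_in eqmodE => /asboolP.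
by apply/eqP; rewrite /dl_in eqmodE; apply/asboolP.
Qed.

Lemma dl_inK (u : dirlim) : dl_in (repr u) = u.
Proof. exact: reprK. Qed.

Lemma dl_in_push x m : (x.1 <= m)%N -> dl_in (m, push x m) = dl_in x.
Proof.
by move=> xm; apply/dl_inP; exists m; split; rewrite // {1}/push big_geq ?mulr1.
Qed.

Lemma dl_in2 (u v : dirlim) : exists k a b, u = dl_in (k, a) /\ v = dl_in (k, b).
Proof.
pose k := maxn (repr u).1 (repr v).1.
exists k, (push (repr u) k), (push (repr v) k).
by rewrite !dl_in_push ?leq_maxl ?leq_maxr // !dl_inK.
Qed.

Definition dl_add (u v : dirlim) : dirlim :=
  let x := repr u in let y := repr v in let k := maxn x.1 y.1 in
  dl_in (k, push x k + push y k).

Definition dl_opp (u : dirlim) : dirlim := dl_in ((repr u).1, - (repr u).2).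

Definition dl_zero : dirlim := dl_in (0%N, 0).

Lemma dl_zeroE k : dl_in (k, 0) = dl_zero.
Proof. by apply/dl_inP; exists k; rewrite /push /= !mul0r. Qed.

Lemma dl_addE k a b : dl_add (dl_in (k, a)) (dl_in (k, b)) = dl_in (k, a + b).
Proof.
rewrite /dl_add; set x := repr _; set y := repr _.
have /dl_inP [m [/= xm km e1]] : dl_in x = dl_in (k, a) by rewrite dl_inK.
have /dl_inP [p [/= yp kp e2]] : dl_in y = dl_in (k, b) by rewrite dl_inK.
set l := maxn x.1 y.1; set q := maxn m p.
have lq : (l <= q)%N.
  by rewrite geq_max (leq_trans xm) ?leq_maxl // (leq_trans yp) ?leq_maxr.
have kq : (k <= q)%N by rewrite (leq_trans km) ?leq_maxl.
apply/dl_inP; exists q; split=> //=.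
rewrite {1}/push /= mulrDl -!pushD ?leq_maxl ?leq_maxr //.
rewrite (@pushD x m) ?xm ?leq_maxl // e1 -pushD ?km ?leq_maxl //.
rewrite (@pushD y p) ?yp ?leq_maxr // e2 -pushD ?kp ?leq_maxr //.
by rewrite /push /= mulrDl.
Qed.

Lemma dl_oppE k a : dl_opp (dl_in (k, a)) = dl_in (k, - a).
Proof.
rewrite /dl_opp; set x := repr _.
have /dl_inP [m [/= xm km e]] : dl_in x = dl_in (k, a) by rewrite dl_inK.
by apply/dl_inP; exists m; split; rewrite // /push /= !mulNr; congr (- _).
Qed.

Lemma dl_addC : commutative dl_add.
Proof.
by move=> u v; have [k [a [b [-> ->]]]] := dl_in2 u v; rewrite !dl_addE addrC.
Qed.

Lemma dl_addA : associative dl_add.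
Proof.
move=> u v w; pose k := maxn (repr u).1 (maxn (repr v).1 (repr w).1).
rewrite -(dl_inK u) -(dl_inK v) -(dl_inK w).
rewrite -(@dl_in_push (repr u) k) ?leq_maxl //.
rewrite -(@dl_in_push (repr v) k) ?leq_max ?leqnn ?orbT //.
rewrite -(@dl_in_push (repr w) k) ?leq_max ?leqnn ?orbT //.
by rewrite !dl_addE addrA.
Qed.

Lemma dl_add0 : left_id dl_zero dl_add.
Proof.
by move=> u; have [k [a [_ [-> _]]]] := dl_in2 u u;
  rewrite -(dl_zeroE k) dl_addE add0r.
Qed.

Lemma dl_addN : left_inverse dl_zero dl_opp dl_add.
Proof.
by move=> u; have [k [a [_ [-> _]]]] := dl_in2 u u;
  rewrite dl_oppE dl_addE addNr dl_zeroE.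
Qed.

HB.instance Definition _ :=
  GRing.isZmodule.Build dirlim dl_addA dl_addC dl_add0 dl_addN.

End DirectLimit.

Record fcsystem (R : realType) := FCSystem {
  salg :> nat -> fcblocks;
  smap : forall k, fcalg R (salg k) -> fcalg R (salg k.+1)
}.

Definition generic_system (R : realType) (S : fcsystem R) :=
  forall k, generic (smap (f := S) (k := k)).

Definition odd_system (R : realType) (S : fcsystem R) :=
  finite_set (fun k : nat =>
    exists m, multiplicity (smap (f := S) (k := k)) m /\ ~~ odd m).

Definition H1_invariant (R : realType) (S : fcsystem R) : zmodType :=
  dirlim (fun k => H1 (smap (f := S) (k := k))).

Definition H1_nonzero (R : realType) (S : fcsystem R) :=
  exists x : H1_invariant S, x <> 0.

Fixpoint siter (R : realType) (S : fcsystem R) (k n : nat) :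
    fcalg R (S k) -> fcalg R (S (n + k)%N) :=
  if n is n'.+1 then fun a => smap (siter n' a) else id.

(** The given embedding A_k -> A_l. *)
Definition strans (R : realType) (S : fcsystem R) (k l : nat) (kl : (k <= l)%N)
    (a : fcalg R (S k)) : fcalg R (S l) :=
  ecast m (fcalg R (S m)) (subnK kl) (siter (l - k) a).

(** A star extendible isomorphism of systems:
    A_(sidx 0) -> A'_(tidx 0) -> A_(sidx 1) -> A'_(tidx 1) -> ... *)
Record star_iso (R : realType) (S S' : fcsystem R) := StarIso {
  sidx : nat -> nat;
  tidx : nat -> nat;
  sidx_lt : {homo sidx : i j / (i < j)%N};
  tidx_lt : {homo tidx : i j / (i < j)%N};
  up : forall i, fcalg R (S (sidx i)) -> fcalg R (S' (tidx i));
  down : forall i, fcalg R (S' (tidx i)) -> fcalg R (S (sidx i.+1));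
  up_star : forall i, star_extendible (@up i);
  down_star : forall i, star_extendible (@down i);
  down_up : forall i a, down (up a) = strans (ltnW (sidx_lt (ltnSn i))) a;
  up_down : forall i b, up (down b) = strans (ltnW (tidx_lt (ltnSn i))) b
}.

(** The crossover maps available for subdiagrams: A_(sidx i) -> A'_(tidx j) for
    i <= j, and A'_(tidx i) -> A_(sidx j.+1) for i <= j. *)
Definition cross_up (R : realType) (S S' : fcsystem R) (D : star_iso S S')
    (i j : nat) (ij : (i <= j)%N) (a : fcalg R (S (sidx D i))) :
    fcalg R (S' (tidx D j)) :=
  up (strans (ltnW_homo (@sidx_lt _ _ _ D) ij) a).

Definition cross_down (R : realType) (S S' : fcsystem R) (D : star_iso S S')
    (i j : nat) (ij : (i <= j)%N) (b : fcalg R (S' (tidx D i))) :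
    fcalg R (S (sidx D j.+1)) :=
  down (strans (ltnW_homo (@tidx_lt _ _ _ D) ij) b).

(** Some subdiagram
    A_(sidx (s 0)) -> A'_(tidx (t 0)) -> A_(sidx (s 1)) -> A'_(tidx (t 1)) -> ...
    has regular crossover maps; here s k.+1 = (u k).+1. *)
Definition regular_iso (R : realType) (S S' : fcsystem R) (D : star_iso S S') :=
  exists (s t u : nat -> nat)
    (st : forall k, (s k <= t k)%N) (tu : forall k, (t k <= u k)%N),
    (forall k, s k.+1 = (u k).+1) /\
    forall k, regular (cross_up (D := D) (st k)) /\
              regular (cross_down (D := D) (tu k)).

(* Main.v *)
Require Import Defs.
From mathcomp Require Import all_boot all_order all_algebra all_fingroup.
From mathcomp Require Import spectral complex.
From mathcomp Require Import all_classical all_reals.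
From HB Require Import structures.
From mathcomp Require mxtens.
From mathcomp Require Import ring.

(** Write the extension of a star extendible map [A -> B] as
    [a |-> sum_xy a_xy v_x v_y^*], where the [v_x] are isometries with orthogonal
    ranges, defined on a multiplicity space [M].  Compressing by [v_x] the block
    projections of [B] gives, for each block of [A], a decomposition of [M], and
    the map is regular iff these decompositions commute.  Composition of maps
    corresponds to the tensor product of multiplicity spaces.  A map with the block
    behaviour of a rigid one is encoded by two symmetries [u], [w] of [M]; it is
    rigid when [u w = w u], and then [H_1] acts as multiplication by [tr (u w)].

    If [g \o f] is rigid, with symmetries [U], [W], comparing its compressions over
    the blocks 1, 2 (resp. 3, 4) forces [f] to have the block behaviour above and
    [U = u (x) u'], [W = w (x) w'], where [u], [w] belong to [f].  As [U] and [W]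
    commute, [u] and [w] commute or anticommute.  In the latter case the space of
    [f] has even dimension and [tr (u w) = 0], which is excluded both for an odd
    system and for a system with nonzero [H_1].  Hence all crossover maps are
    regular from some index on. *)

Set Implicit Arguments.
Unset Strict Implicit.
Unset Printing Implicit Defensive.

Import Order.TTheory GRing.Theory Num.Theory.
Local Open Scope ring_scope.
Local Open Scope sesquilinear_scope.

Local Notation "A *t B" := (mxtens.tensmx A B) (at level 40, left associativity).
Local Notation tpair := mxtens.mxtens_index.
Local Notation tunpair := mxtens.mxtens_unindex.

(** * Adjoints and projections *)

Section Adjoint.
Variable C : numClosedFieldType.

Lemma adjmxE m n (A : 'M[C]_(m, n)) i j : (A ^t*) i j = (A j i)^*.
Proof. by rewrite !mxE. Qed.

Lemma adjmxM m n p (A : 'M[C]_(m, n)) (B : 'M[C]_(n, p)) :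
  (A *m B) ^t* = B ^t* *m A ^t*.
Proof. by rewrite trmx_mul map_mxM. Qed.

Lemma adjmxZ m n a (A : 'M[C]_(m, n)) : (a *: A) ^t* = a^* *: A ^t*.
Proof. by apply/matrixP => i j; rewrite !mxE rmorphM. Qed.

Lemma adjmx_sum m n (I : finType) (A : I -> 'M[C]_(m, n)) :
  (\sum_i A i) ^t* = \sum_i (A i) ^t*.
Proof. by rewrite !raddf_sum. Qed.

(** Each diagonal entry of [A ^t* *m A] is the sum of the squared moduli of a column of [A]. *)
Lemma mulmx_adj_eq0 m n (A : 'M[C]_(m, n)) : A ^t* *m A = 0 -> A = 0.
Proof.
move=> A0; apply/matrixP => i j; rewrite mxE; apply/eqP.
have /matrixP/(_ j j) := A0; rewrite !mxE => /eqP.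
rewrite psumr_eq0 => [/allP/(_ i (mem_index_enum i))|k _]; last first.
  by rewrite adjmxE mulrC mul_conjC_ge0.
by rewrite adjmxE mulrC mul_conjC_eq0.
Qed.

(** Gram-Schmidt gives [U] whose rows are an orthonormal basis of the row space of [p]. From U p = U
    follows p U^* = U^*, hence p = p U^* U = U^* U. *)
Lemma proj_factor n (p : 'M[C]_n) : p *m p = p -> p ^t* = p ->
  exists m (W : 'M[C]_(n, m)), W ^t* *m W = 1%:M /\ W *m W ^t* = p.
Proof.
move=> pp ps; exists (\rank p), ((schmidt (row_base p)) ^t*).
set U := schmidt _; rewrite trmxCK.
have Uu : U *m U ^t* = 1%:M by apply/unitarymxP/schmidt_unitarymx/rank_leq_row.
split=> //; have eU : (U :=: p)%MS.
  by apply: eqmx_trans (eq_row_base p); apply/eqmx_schmidt_free/row_base_free.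
have /submxP [Y UY] : (U <= p)%MS by rewrite eU.
have /submxP [Z pZ] : (p <= U)%MS by rewrite eU.
have Up : U *m p = U by rewrite UY -mulmxA pp.
have pU : p *m (U ^t* *m U) = p by rewrite {1}pZ mulmxA -(mulmxA Z) Uu mulmx1.
have pU' : p *m U ^t* = U ^t*.
  by have := congr1 (fun M => M ^t*) Up; rewrite /= adjmxM ps.
by apply: etrans pU; rewrite mulmxA pU'.
Qed.

End Adjoint.

(** * Families of isometries and star homomorphisms *)

Section Families.
Variable C : numClosedFieldType.

Definition isofam r n m (v : 'I_r -> 'M[C]_(n, m)) :=
  forall x y, (v x) ^t* *m v y = (x == y)%:R%:M.

Definition famhom r n m (v : 'I_r -> 'M[C]_(n, m)) (a : 'M[C]_r) : 'M[C]_n :=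
  \sum_x \sum_y a x y *: (v x *m (v y) ^t*).

Lemma famhom_delta r n m (v : 'I_r -> 'M[C]_(n, m)) x y :
  famhom v (delta_mx x y) = v x *m (v y) ^t*.
Proof.
rewrite /famhom (bigD1 x) //= (bigD1 y) //= big1 => [|y' /negPf ny].
  rewrite big1 => [|x' /negPf nx]; first by rewrite !mxE !eqxx scale1r !addr0.
  by rewrite big1 // => y' _; rewrite mxE nx scale0r.
by rewrite mxE ny andbF scale0r.
Qed.

Lemma famhom_is_linear r n m (v : 'I_r -> 'M[C]_(n, m)) : linear (famhom v).
Proof.
move=> a A B; rewrite /famhom scaler_sumr -big_split; apply: eq_bigr => x _ /=.
rewrite scaler_sumr -big_split; apply: eq_bigr => y _ /=.
by rewrite !mxE scalerDl scalerA.
Qed.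

HB.instance Definition _ r n m (v : 'I_r -> 'M[C]_(n, m)) :=
  GRing.isLinear.Build C 'M[C]_r 'M[C]_n _ (famhom v) (famhom_is_linear v).

Lemma famhomM r n m (v : 'I_r -> 'M[C]_(n, m)) :
  isofam v -> {morph famhom v : x y / x *m y}.
Proof.
move=> iv A B; rewrite {2 3}/famhom mulmx_suml; apply: eq_bigr => x _.
transitivity (\sum_y \sum_z (A x z * B z y) *: (v x *m (v y) ^t*)).
  by apply: eq_bigr => y _; rewrite mxE scaler_suml.
rewrite exchange_big /= mulmx_suml; apply: eq_bigr => z _.
rewrite mulmx_sumr [RHS](bigD1 z) //= [X in _ = _ + X]big1 => [|z' /negPf nz].
  rewrite addr0 mulmx_sumr; apply: eq_bigr => y _.
  rewrite -scalemxAl -scalemxAr scalerA; congr (_ *: _).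
  by rewrite mulmxA -(mulmxA (v x)) iv eqxx mulmx1.
rewrite mulmx_sumr big1 // => y _; rewrite -scalemxAl -scalemxAr.
by rewrite mulmxA -(mulmxA (v x)) iv eq_sym nz raddf0 mulmx0 mul0mx !scaler0.
Qed.

Lemma famhom_adj r n m (v : 'I_r -> 'M[C]_(n, m)) a :
  famhom v (a ^t*) = (famhom v a) ^t*.
Proof.
rewrite {2}/famhom adjmx_sum.
under [RHS]eq_bigr do rewrite adjmx_sum.
rewrite exchange_big /=; apply: eq_bigr => x _; apply: eq_bigr => y _.
by rewrite adjmxZ adjmxM trmxCK !mxE.
Qed.

Lemma linear_deltaE r n (F : 'M[C]_r -> 'M[C]_n) : linear F ->
  forall a, F a = \sum_x \sum_y a x y *: F (delta_mx x y).
Proof.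
move=> lF a; pose L : {linear 'M[C]_r -> 'M[C]_n} :=
  HB.pack F (GRing.isLinear.Build C 'M[C]_r 'M[C]_n *:%R F lF).
have -> : F a = L a by [].
rewrite {1}(matrix_sum_delta a) linear_sum; apply: eq_bigr => x _.
by rewrite linear_sum; apply: eq_bigr => y _; rewrite linearZ.
Qed.

(* Multiplicity space: v_x maps an orthonormal basis of the range of
   F(e_x0x0) to the range of F(e_xx) by means of F(e_xx0). *)
Lemma star_hom_famhom r n (F : 'M[C]_r -> 'M[C]_n) (x0 : 'I_r) :
  linear F -> {morph F : x y / x *m y} -> (forall x, F (x ^t*) = (F x) ^t*) ->
  exists m (v : 'I_r -> 'M[C]_(n, m)), isofam v /\ F =1 famhom v.
Proof.
move=> lF mF sF; pose e x y := F (delta_mx x y).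
have F0 : F 0 = 0 by have := lF (-1) 0 0; rewrite scaler0 add0r scaleN1r addNr.
have eM x y z t : e x y *m e z t = if y == z then e x t else 0.
  rewrite /e -mF; case: eqVneq => [->|nyz]; first by rewrite mul_delta_mx.
  by rewrite mul_delta_mx_0.
have eA x y : (e x y) ^t* = e y x.
  by rewrite /e -sF; congr F; apply/matrixP => i j; rewrite !mxE andbC conjC_nat.
have [||m [W [W1 W2]]] := @proj_factor C n (e x0 x0).
- by rewrite eM eqxx.
- by rewrite eA.
exists m, (fun x => e x x0 *m W); split=> [x y|a].
  rewrite adjmxM eA mulmxA -(mulmxA _ _ (e y x0)) eM.
  case: eqVneq => _; last by rewrite mulmx0 mul0mx raddf0.
  by rewrite -W2 mulmxA W1 mul1mx W1.
rewrite (linear_deltaE lF); apply: eq_bigr => x _; apply: eq_bigr => y _.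
congr (_ *: _); rewrite adjmxM mulmxA -(mulmxA _ W) W2 eM eqxx eA.
by rewrite eM eqxx.
Qed.

(** The multiplicity space is unique up to a unitary: since v_x v_y^* = v'_x v'_y^*, the single
    matrix [c], read off at [x0], transports every v'_x to v_x. *)
Lemma isofam_change r n m m' (v : 'I_r -> 'M[C]_(n, m))
    (v' : 'I_r -> 'M[C]_(n, m')) x0 : isofam v -> isofam v' ->
  famhom v =1 famhom v' ->
  let c := (v' x0) ^t* *m v x0 in
  [/\ forall x, v x = v' x *m c, c ^t* *m c = 1%:M & c *m c ^t* = 1%:M].
Proof.
move=> iv iv' e c.
have e2 x y : v x *m (v y) ^t* = v' x *m (v' y) ^t* by rewrite -!famhom_delta e.
have vc x : v x = v' x *m c.
  by rewrite /c mulmxA -e2 -mulmxA iv eqxx mulmx1.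
split=> //.
  by rewrite {1}/c adjmxM trmxCK -mulmxA -vc iv eqxx.
by rewrite /c adjmxM trmxCK mulmxA -(mulmxA _ (v x0)) e2 !mulmxA iv' eqxx mul1mx
           iv' eqxx.
Qed.

(** With f = g \o c for a block index [c], this is the combination of the block projections with
    coefficients g(i); [sgn \o c] gives the sign matrix that tells the two blocks of a side
    apart. *)
Definition diagfun_mx n (f : 'I_n -> C) : 'M[C]_n := diag_mx (\row_z f z).

Lemma diagfun_mulE n m f (A : 'M[C]_(n, m)) i j : (diagfun_mx f *m A) i j = f i * A i j.
Proof. by rewrite mul_diag_mx !mxE. Qed.

Lemma mul_diagfunE n m f (A : 'M[C]_(m, n)) i j : (A *m diagfun_mx f) i j = A i j * f j.
Proof. by rewrite mul_mx_diag !mxE. Qed.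

Lemma diagfun_adj n (f : 'I_n -> C) :
  (forall z, (f z)^* = f z) -> (diagfun_mx f) ^t* = diagfun_mx f.
Proof.
move=> fr; apply/matrixP => i j; rewrite !mxE eq_sym.
by case: eqVneq => [->|_]; rewrite ?mulr1n ?mulr0n ?fr ?conjC0.
Qed.

Lemma mulmx_neq0 m n p (A : 'M[C]_(m, n)) (B : 'M[C]_(n, p)) i j :
  (A *m B) i j != 0 -> exists k, A i k != 0 /\ B k j != 0.
Proof.
rewrite mxE => /eqP s0; apply: contrapT => /forallNP h; apply: s0.
apply: big1 => k _; apply/eqP; rewrite mulf_eq0; apply/negPn/negP.
by rewrite negb_or => /andP []; move: (h k); tauto.
Qed.

End Families.

(** * Tensor products of multiplicity spaces *)

Section Tensor.
Variable C : numClosedFieldType.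

(** This is W (X (x) 1), where W sends e_y (x) s to w_y s. For X = v_x it is the isometry attached
    to x by the composite map, on the tensor product of the multiplicity spaces. *)
Definition famcomp n p m q (X : 'M[C]_(n, m)) (w : 'I_n -> 'M[C]_(p, q)) :
    'M[C]_(p, m * q) :=
  \matrix_(z, i) \sum_y X y (tunpair i).1 * w y z (tunpair i).2.

Lemma famcompE n p m q (X : 'M[C]_(n, m)) (w : 'I_n -> 'M[C]_(p, q)) z k s :
  famcomp X w z (tpair (k, s)) = \sum_y X y k * w y z s.
Proof. by rewrite mxE mxtens.mxtens_indexK. Qed.

Lemma sum_tpair (V : nmodType) m q (f : 'I_(m * q) -> V) :
  \sum_i f i = \sum_k \sum_s f (tpair (k, s)).
Proof.
rewrite pair_big /= (reindex (@tpair m q)) /=; first by apply: eq_bigr => -[].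
by exists (@tunpair m q) => i _; rewrite (mxtens.mxtens_indexK, mxtens.mxtens_unindexK).
Qed.

Lemma mx_tpairP m q p p' (A B : 'M[C]_(m * q, p * p')) :
  (forall k s l t, A (tpair (k, s)) (tpair (l, t)) = B (tpair (k, s)) (tpair (l, t))) ->
  A = B.
Proof.
move=> h; apply/matrixP => i j.
by case: (mxtens.mxtens_indexP i) => k s; case: (mxtens.mxtens_indexP j).
Qed.

Lemma mx_tpairrP m p p' (A B : 'M[C]_(m, p * p')) :
  (forall z l t, A z (tpair (l, t)) = B z (tpair (l, t))) -> A = B.
Proof.
by move=> h; apply/matrixP => i j; case: (mxtens.mxtens_indexP j).
Qed.

Lemma tensmx_scalar m q (a b : C) :
  (a%:M : 'M[C]_m) *t (b%:M : 'M[C]_q) = (a * b)%:M.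
Proof.
apply: mx_tpairP => k s l t; rewrite mxtens.tensmxE !mxE.
rewrite (inj_eq (can_inj (@mxtens.mxtens_indexK m q))) xpair_eqE.
by case: eqP => _; case: eqP => _; rewrite ?(mulr0, mul0r).
Qed.

Lemma tensmxDl m n p q (A A' : 'M[C]_(m, n)) (B : 'M[C]_(p, q)) :
  (A + A') *t B = A *t B + A' *t B.
Proof. by apply/matrixP => i j; rewrite !mxE mulrDl. Qed.

Lemma tensmxDr m n p q (A : 'M[C]_(m, n)) (B B' : 'M[C]_(p, q)) :
  A *t (B + B') = A *t B + A *t B'.
Proof. by apply/matrixP => i j; rewrite !mxE mulrDr. Qed.

Lemma tensmxZl m n p q a (A : 'M[C]_(m, n)) (B : 'M[C]_(p, q)) :
  (a *: A) *t B = a *: (A *t B).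
Proof. by apply/matrixP => i j; rewrite !mxE mulrA. Qed.

Lemma tensmxZr m n p q a (A : 'M[C]_(m, n)) (B : 'M[C]_(p, q)) :
  A *t (a *: B) = a *: (A *t B).
Proof. by apply/matrixP => i j; rewrite !mxE mulrCA. Qed.

Lemma tensmx_eq0 m n p q (A : 'M[C]_(m, n)) (B : 'M[C]_(p, q)) :
  A *t B = 0 -> A = 0 \/ B = 0.
Proof.
move=> AB0; have [->|/matrix0Pn [i [j nz]]] := eqVneq A 0; first by left.
right; apply/matrixP => s t; have /matrixP/(_ (tpair (i, s)) (tpair (j, t))) := AB0.
rewrite mxtens.tensmxE !mxE => /eqP; rewrite mulf_eq0 (negPf nz) => /eqP ->.
by [].
Qed.

Lemma mxtrace_tens m q (A : 'M[C]_m) (B : 'M[C]_q) : \tr (A *t B) = \tr A * \tr B.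
Proof.
rewrite /mxtrace sum_tpair mulr_suml; apply: eq_bigr => k _.
by rewrite mulr_sumr; apply: eq_bigr => s _; rewrite mxtens.tensmxE.
Qed.

(** At a nonzero entry (s, t) of [B] the identity reads A B_st = B'_st 1, which determines the
    scalar. *)
Lemma tens_eq_scalar m q (A : 'M[C]_m) (B B' : 'M[C]_q) :
  A *t B = 1%:M *t B' -> B = 0 \/ exists a, A = a%:M.
Proof.
move=> e; have [->|/matrix0Pn [s [t nz]]] := eqVneq B 0; first by left.
right; exists (B' s t / B s t); apply/matrixP => i j.
have /matrixP/(_ (tpair (i, s)) (tpair (j, t))) := e.
rewrite !mxtens.tensmxE !mxE => /(canRL (mulfK nz)) ->.
by case: (i == j); rewrite ?mul1r ?mul0r.
Qed.

Lemma famcompMl n p m m' q q' (X : 'M[C]_(n, m)) (A : 'M_(m, m'))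
    (w : 'I_n -> 'M[C]_(p, q)) (B : 'M_(q, q')) :
  famcomp (X *m A) (fun y => w y *m B) = famcomp X w *m (A *t B).
Proof.
apply: mx_tpairrP => z l t; rewrite famcompE mxE sum_tpair.
transitivity (\sum_k \sum_s \sum_y X y k * A k l * (w y z s * B s t)).
  under eq_bigr => y _ do rewrite !mxE mulr_suml.
  rewrite exchange_big; apply: eq_bigr => k _ /=.
  by rewrite exchange_big /=; apply: eq_bigr => y _; rewrite mulr_sumr.
apply: eq_bigr => k _; apply: eq_bigr => s _.
rewrite famcompE mxtens.tensmxE mulr_suml; apply: eq_bigr => y _; ring.
Qed.

Lemma famcomp_lmul n p p' m q (N : 'M_(p', p)) (X : 'M[C]_(n, m))
    (w : 'I_n -> 'M[C]_(p, q)) :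
  N *m famcomp X w = famcomp X (fun y => N *m w y).
Proof.
apply: mx_tpairrP => z l t; rewrite famcompE mxE.
under [RHS]eq_bigr do rewrite mxE mulr_sumr.
rewrite exchange_big /=; apply: eq_bigr => z' _.
rewrite famcompE mulr_sumr; apply: eq_bigr => y _; ring.
Qed.

Lemma famcomp_dg n p m q f (X : 'M[C]_(n, m)) (w : 'I_n -> 'M[C]_(p, q)) :
  famcomp (diagfun_mx f *m X) w = famcomp X (fun y => f y *: w y).
Proof.
apply: mx_tpairrP => z l t; rewrite !famcompE; apply: eq_bigr => y _.
by rewrite diagfun_mulE mxE mulrCA mulrA.
Qed.

Lemma eq_famcomp n p m q (X : 'M[C]_(n, m)) (w w' : 'I_n -> 'M[C]_(p, q)) :
  (forall y k, X y k != 0 -> w y = w' y) -> famcomp X w = famcomp X w'.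
Proof.
move=> h; apply: mx_tpairrP => z l t; rewrite !famcompE; apply: eq_bigr => y _.
by have [->|/h ->//] := eqVneq (X y l) 0; rewrite !mul0r.
Qed.

Lemma famcomp_adjM n p m m' q (X : 'M[C]_(n, m)) (X' : 'M[C]_(n, m'))
    (w : 'I_n -> 'M[C]_(p, q)) : isofam w ->
  (famcomp X w) ^t* *m famcomp X' w = (X ^t* *m X') *t 1%:M.
Proof.
move=> iw; apply: mx_tpairP => k s l t; rewrite mxtens.tensmxE mxE.
transitivity (\sum_y \sum_y' ((X y k)^* * X' y' l) * ((w y) ^t* *m w y') s t).
  under eq_bigr => z _ do rewrite adjmxE !famcompE raddf_sum mulr_suml.
  rewrite exchange_big /=; apply: eq_bigr => y _.
  under eq_bigr => z _ do rewrite mulr_sumr.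
  rewrite exchange_big /=; apply: eq_bigr => y' _.
  rewrite mxE mulr_sumr; apply: eq_bigr => z _.
  by rewrite adjmxE rmorphM /= mulrACA.
rewrite mxE mulr_suml; apply: eq_bigr => y _.
rewrite (bigD1 y) //= big1 => [|y' ny]; last first.
  by rewrite iw eq_sym (negPf ny) raddf0 mxE mulr0.
by rewrite iw eqxx addr0 adjmxE.
Qed.

(** The matrix unit e_xy goes to v_x v_y^* under the first map; taking X = v_x and Y = v_y, this
    shows that composing maps amounts to tensoring multiplicity spaces. *)
Lemma famhom_famcomp n p m q (X Y : 'M[C]_(n, m)) (w : 'I_n -> 'M[C]_(p, q)) :
  famhom w (X *m Y ^t*) = famcomp X w *m (famcomp Y w) ^t*.
Proof.
apply/matrixP => z z'; rewrite mxE sum_tpair.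
transitivity (\sum_k \sum_s \sum_y \sum_y' X y k * w y z s * (Y y' k * w y' z' s)^*).
  under [RHS]eq_bigr => k _ do under eq_bigr => s _ do rewrite exchange_big.
  rewrite /famhom summxE; under [LHS]eq_bigr do rewrite summxE.
  have -> : \sum_k \sum_s \sum_y' \sum_y X y k * w y z s * (Y y' k * w y' z' s)^* =
    \sum_y \sum_y' \sum_k \sum_s X y k * w y z s * (Y y' k * w y' z' s)^*.
    under eq_bigr => k _ do rewrite exchange_big /=.
    under eq_bigr => k _ do under eq_bigr => y' _ do rewrite exchange_big /=.
    rewrite exchange_big /=.
    under eq_bigr => y' _ do rewrite exchange_big /=.
    by rewrite exchange_big.
  apply: eq_bigr => y _; apply: eq_bigr => y' _; rewrite !mxE mulr_suml.
  apply: eq_bigr => k _; rewrite mulr_sumr; apply: eq_bigr => s _.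
  rewrite !mxE rmorphM /=; ring.
apply: eq_bigr => k _; apply: eq_bigr => s _.
rewrite adjmxE !famcompE raddf_sum mulr_suml; apply: eq_bigr => y _.
by rewrite mulr_sumr.
Qed.

Lemma isofam_famcomp r n p m q (v : 'I_r -> 'M[C]_(n, m)) (w : 'I_n -> 'M[C]_(p, q)) :
  isofam v -> isofam w -> isofam (fun x => famcomp (v x) w).
Proof.
move=> iv iw x y; rewrite famcomp_adjM // iv tensmx_scalar mulr1.
by [].
Qed.

Lemma famhom_comp r n p m q (v : 'I_r -> 'M[C]_(n, m)) (w : 'I_n -> 'M[C]_(p, q)) a :
  famhom w (famhom v a) = famhom (fun x => famcomp (v x) w) a.
Proof.
rewrite {2}/famhom linear_sum; apply: eq_bigr => x _.
rewrite linear_sum; apply: eq_bigr => y _.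
by rewrite linearZ /= famhom_famcomp.
Qed.

End Tensor.

(** * Pairs of symmetries *)

Section Rigid.
Variable C : numClosedFieldType.

Definition upper (i : 'I_4) := (i < 2)%N.
(** The sign is 1 on the first block of each side and -1 on the second, so that side and sign
    together determine the block. *)
Definition sgn (i : 'I_4) : C := (-1) ^+ i.

Lemma sgn_sqr i : sgn i * sgn i = 1.
Proof. by rewrite /sgn -exprMn mulrNN mulr1 expr1n. Qed.

Lemma sgn_conj i : (sgn i)^* = sgn i.
Proof. by rewrite /sgn rmorphXn /= rmorphN1. Qed.

Lemma block_eq i j : upper i = upper j -> sgn i = sgn j -> i = j.
Proof.
have n1 : (1 : C) <> -1.
  by move=> /eqP; rewrite -subr_eq0 opprK (pnatr_eq0 C 2).
case: i => [[|[|[|[]]]] //] ?; case: j => [[|[|[|[]]]] //] ?;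
 rewrite /upper /sgn /= ?expr0 ?expr1 ?sqrrN ?exprS ?expr0 ?mulr1 ?mulN1r ?opprK => h1 h2;
 try (by []);
 try (by apply: val_inj); by case: n1.
Qed.

(** [u] is 1 on the part of the multiplicity space over which blocks 1 and 2 are
    preserved and -1 on the part over which they are exchanged; [w] likewise for
    3 and 4.  The map is rigid iff moreover [u] and [w] commute. *)
Definition symfam r n m (b : 'I_r -> 'I_4) (c : 'I_n -> 'I_4)
    (v : 'I_r -> 'M[C]_(n, m)) (u w : 'M[C]_m) :=
  [/\ isofam v,
      forall x z k, v x z k != 0 -> upper (c z) = upper (b x) &
      forall x, diagfun_mx (sgn \o c) *m v x =
                sgn (b x) *: (v x *m (if upper (b x) then u else w))].

(** The condition that [famhom v] maps the first 4-cycle algebra into the second, tested on matrix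
    units. *)
Definition block_hom r n m (b : 'I_r -> 'I_4) (c : 'I_n -> 'I_4)
    (v : 'I_r -> 'M[C]_(n, m)) :=
  forall x y z t, fcsupp (b x) (b y) -> (v x *m (v y) ^t*) z t != 0 ->
    fcsupp (c z) (c t).

Lemma symfam_conj r n m m' b c v u w v' h :
  @symfam r n m b c v u w -> isofam v' ->
  (forall x, v' x = v x *m h) -> h *m h ^t* = 1%:M ->
  @symfam r n m' b c v' (h ^t* *m u *m h) (h ^t* *m w *m h).
Proof.
case=> iv cv sv iv' vh hh; split=> // [x z k|x].
  by rewrite vh => /mulmx_neq0 [l [/cv]].
rewrite vh mulmxA sv -scalemxAl; congr (_ *: _).
by case: ifP => _; rewrite !mulmxA -(mulmxA (v x) h) hh mulmx1.
Qed.

(** All y in the support of v_x lie on the side of x, so the second map acts on every such w_y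
    through the same symmetry. The remaining signs sgn(c y) reassemble into the sign matrix applied
    to v_x, which produces the symmetry of the first map. *)
Lemma symfam_comp r n p m q b c d v u w v' u' w' :
  @symfam r n m b c v u w -> @symfam n p q c d v' u' w' ->
  symfam b d (fun x => famcomp (v x) v') (u *t u') (w *t w').
Proof.
case=> iv cv sv [iv' cv' sv']; split.
- exact: isofam_famcomp.
- move=> x z i; case: (mxtens.mxtens_indexP i) => k s; rewrite famcompE => nz.
  have [y /andP [ny ny']] : exists y, (v x y k != 0) && (v' y z s != 0).
    apply: contrapT => /forallNP h; case/eqP: nz; apply: big1 => y _; apply/eqP.
    by rewrite mulf_eq0; apply/negPn; rewrite negb_or; apply/negP/h.
  by rewrite (cv' _ _ _ ny') (cv _ _ _ ny).
move=> x; rewrite famcomp_lmul.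
pose s := if upper (b x) then u' else w'.
rewrite (@eq_famcomp C n p m q _ _ (fun y => sgn (c y) *: (v' y *m s))); last first.
  by move=> y k /cv e; rewrite sv' e.
rewrite -(famcomp_dg (sgn \o c) (v x) (fun y => v' y *m s)) sv.
rewrite scalemxAr famcompMl tensmxZl -scalemxAr /s.
by case: ifP.
Qed.

End Rigid.

(** * Factorizations of rigid maps *)

Section Factor.
Variable C : numClosedFieldType.

Lemma fcsupp_anti i j : fcsupp i j -> fcsupp j i -> i = j.
Proof.
rewrite /fcsupp => /predU1P [//|/andP [i2 j2]] /predU1P [//|/andP [j2' _]].
by move: j2; rewrite leqNgt j2'.
Qed.

Lemma fcsuppxx i : fcsupp i i.
Proof. by rewrite /fcsupp eqxx. Qed.

Lemma fcsupp_upper i j : upper i -> ~~ upper j -> fcsupp i j.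
Proof. by rewrite /fcsupp /upper -leqNgt => -> ->; rewrite orbT. Qed.

Lemma scalarmx_neq0 m (a : C) : (0 < m)%N -> a != 0 -> (a%:M : 'M[C]_m) != 0.
Proof.
case: m => // m _ a0; apply/eqP => /matrixP/(_ 0 0); rewrite !mxE => /eqP.
by rewrite (negPf a0).
Qed.

Lemma sqr1_neq0 m (u : 'M[C]_m) : (0 < m)%N -> u *m u = 1%:M -> u != 0.
Proof.
move=> m0 uu; apply: contra_eq_neq uu => ->; rewrite mul0mx eq_sym.
by rewrite scalarmx_neq0 ?oner_eq0.
Qed.

(** * Compressions of the block projections by one map *)

Section BlockHom.
Variables (r n m : nat) (b : 'I_r -> 'I_4) (c : 'I_n -> 'I_4).
Variable v : 'I_r -> 'M[C]_(n, m).
Hypotheses (iv : isofam v) (bv : block_hom b c v).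

(** For x, y in one block, v_x v_y^* and its adjoint v_y v_x^* both respect the support pattern,
    which is antisymmetric; so v_x v_y^* is block diagonal. *)
Lemma block_hom_dg g x y : b x = b y ->
  diagfun_mx (g \o c) *m (v x *m (v y) ^t*) = v x *m (v y) ^t* *m diagfun_mx (g \o c).
Proof.
move=> bxy; apply/matrixP => z t; rewrite diagfun_mulE mul_diagfunE mulrC.
have [->|nz] := eqVneq ((v x *m (v y) ^t*) z t) 0; first by rewrite !mul0r.
congr (_ * g _); apply: fcsupp_anti; first by apply: bv nz; rewrite bxy fcsuppxx.
apply: (bv (x := y) (y := x)); first by rewrite bxy fcsuppxx.
by rewrite -[v y]trmxCK -adjmxM adjmxE conjC_eq0.
Qed.

(** The range of v_x is invariant under block projections, and the operator induced on the
    multiplicity space depends only on the block of x. *)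
Lemma block_hom_dgE g x y : b x = b y ->
  diagfun_mx (g \o c) *m v x = v x *m ((v y) ^t* *m diagfun_mx (g \o c) *m v y).
Proof.
move=> bxy; rewrite !mulmxA -(block_hom_dg g bxy) -!mulmxA iv eqxx mulmx1.
by [].
Qed.

Lemma block_hom_dg_orth g x y : x != y -> (v x) ^t* *m diagfun_mx (g \o c) *m v y = 0.
Proof.
move=> nxy; rewrite -mulmxA (block_hom_dgE g (erefl (b y))) mulmxA iv (negPf nxy).
by rewrite raddf0 mul0mx.
Qed.

(** The sign matrix squares to 1 and leaves the range of v_x invariant, so its compression squares
    to 1 as well. *)
Lemma block_hom_sym x : let a := (v x) ^t* *m diagfun_mx (@sgn C \o c) *m v x in
  a *m a = 1%:M.
Proof.
move=> a; have ja := block_hom_dgE (@sgn C) (erefl (b x)).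
rewrite {1}/a -mulmxA -mulmxA -ja [diagfun_mx _ *m (_ *m _)]mulmxA.
have -> : diagfun_mx (@sgn C \o c) *m diagfun_mx (@sgn C \o c) = 1%:M.
  apply/matrixP => i j; rewrite mul_diagfunE !mxE; case: eqVneq => [->|_].
    by rewrite !mulr1n /= sgn_sqr.
  by rewrite mul0r.
by rewrite mul1mx iv eqxx.
Qed.

End BlockHom.

(** * Preservation of the two sides by a first factor *)

Section Side.
Variables (r n p m q : nat).
Variables (b : 'I_r -> 'I_4) (c : 'I_n -> 'I_4) (d : 'I_p -> 'I_4).
Variables (v : 'I_r -> 'M[C]_(n, m)) (w : 'I_n -> 'M[C]_(p, q)).
Hypotheses (iv : isofam v) (bv : block_hom b c v).
Hypotheses (iw : isofam w) (bw : block_hom c d w).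

(** Let [N] project onto the blocks on the wrong side. It kills the composite, a combination of the
    w_y. Multiplying by w_y^* isolates one term, because w_y^* N w_y' = 0 for y' distinct from y,
    and leaves w_y^* N w_y = 0, that is N w_y = 0. *)
Lemma factor_supp x y k :
  (forall z i, famcomp (v x) w z i != 0 -> upper (d z) = upper (b x)) ->
  v x y k != 0 -> forall z s, w y z s != 0 -> upper (d z) = upper (b x).
Proof.
move=> tx nz; pose g i : C := (upper i != upper (b x))%:R.
pose N := diagfun_mx (g \o d).
have gg i : g i * g i = g i by rewrite /g; case: (_ != _); rewrite ?mulr1 ?mulr0.
have Nt : N *m famcomp (v x) w = 0.
  apply/matrixP => z i; rewrite diagfun_mulE [RHS]mxE; apply/eqP; rewrite mulf_eq0 orbC.
  by have [//|/tx e] := eqVneq; rewrite /g /= e eqxx eqxx.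
have NN : N ^t* *m N = N.
  rewrite diagfun_adj => [|z]; last by rewrite /= /g conjC_nat.
  apply/matrixP => z t; rewrite mul_diagfunE !mxE; case: eqVneq => [->|_].
    by rewrite mulr1n /= gg.
  by rewrite mul0r.
have Nw : N *m w y = 0.
  apply: mulmx_adj_eq0; rewrite adjmxM mulmxA -(mulmxA _ _ N) NN.
  apply/matrixP => s s'.
  have /matrixP/(_ s (tpair (k, s'))) := congr1 (mulmx ((w y) ^t*)) Nt.
  rewrite mulmxA famcomp_lmul famcompE mulmx0 [in RHS]mxE (bigD1 y) //=.
  rewrite big1 => [|y' ny]; last first.
    by rewrite (block_hom_dg_orth iw bw) 1?eq_sym // mxE mulr0.
  by rewrite addr0 => /eqP; rewrite mulf_eq0 (negPf nz) => /eqP ->; rewrite mxE.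
move=> z s nw; have /matrixP/(_ z s) := Nw; rewrite diagfun_mulE [RHS]mxE => /eqP.
by rewrite mulf_eq0 (negPf nw) orbF /= /g pnatr_eq0 eqb0 negbK => /eqP.
Qed.

(** If v_x met a block on the wrong side at y, then v_x' for some x' on the other side would meet
    that same block at some y'. By [factor_supp] the ranges of w_y and w_y' would lie on opposite
    sides, although y and y' share a block. *)
Lemma factor_upper : (0 < q)%N -> (forall i, exists x, b x = i) ->
  (forall x z i, famcomp (v x) w z i != 0 -> upper (d z) = upper (b x)) ->
  forall x y k, v x y k != 0 -> upper (c y) = upper (b x).
Proof.
move=> q0 sb tv x y k nz; case: (eqVneq (upper (c y)) (upper (b x))) => [//|ncb]; exfalso.
have [x' bx'] : exists x', upper (b x') = ~~ upper (b x).
  have [x0 b0] := sb 0; have [x2 b2] := sb 2%:R.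
  by case ubx: (upper (b x)); [exists x2; rewrite b2 | exists x0; rewrite b0].
have vx : v x = v x *m (v x') ^t* *m v x' by rewrite -mulmxA iv eqxx mulmx1.
have [y' [nM nz']] : exists y', (v x *m (v x') ^t*) y y' != 0 /\ v x' y' k != 0.
  by apply: mulmx_neq0; rewrite -vx.
(* A nonzero entry between y and y' must respect the support pattern; with y on the wrong side only
   the diagonal case is left. *)
have cyy : c y = c y'.
  case ubx: (upper (b x)) ncb bx' => ncb bx'.
    have /predU1P [//|/andP [cy _]] : fcsupp (c y) (c y').
      by apply: bv nM; rewrite fcsupp_upper ?ubx ?bx'.
    by move: ncb; rewrite /upper cy.
  have /predU1P [//|/andP [_ cy]] : fcsupp (c y') (c y).
    apply: (bv (x := x') (y := x)); first by rewrite fcsupp_upper ?ubx ?bx'.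
    by rewrite -[v x']trmxCK -adjmxM adjmxE conjC_eq0.
  by move: ncb; rewrite /upper ltnNge cy.
pose g i : C := (upper i)%:R.
have gw x1 y1 k1 : v x1 y1 k1 != 0 -> diagfun_mx (g \o d) *m w y1 = g (b x1) *: w y1.
  move=> nz1; apply/matrixP => z s; rewrite diagfun_mulE [RHS]mxE.
  have [->|nw] := eqVneq (w y1 z s) 0; first by rewrite !mulr0.
  by rewrite /= /g (factor_supp (@tv x1) nz1 nw).
have : w y *m (w y') ^t* *m (diagfun_mx (g \o d) *m w y') = g (b x) *: w y.
  rewrite mulmxA -(block_hom_dg bw g cyy) -mulmxA -mulmxA iw eqxx mulmx1.
  exact: gw nz.
rewrite (gw _ _ _ nz') -scalemxAr -mulmxA iw eqxx mulmx1 => /eqP.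
rewrite -subr_eq0 -scalerBl scaler_eq0 => /orP [|/eqP w0].
  by rewrite /g bx' subr_eq0 eqr_nat; case: (upper _).
have := iw y y; rewrite w0 mulmx0 eqxx => /esym/eqP.
by rewrite (negPf (scalarmx_neq0 _ _)) // oner_eq0.
Qed.

End Side.

(** Adding the two equations shows that r0 = r1 or that a0 + a1 is a scalar. The case r0 = r1 and
    the case of a nonzero scalar both yield U = -U, which is absurd; a zero scalar gives the
    conclusion. *)
Lemma tens_sym_split m q (a0 a1 : 'M[C]_m) (r0 r1 : 'M[C]_q) (U : 'M[C]_(m * q)) :
  (0 < m * q)%N -> a0 *m a0 = 1%:M -> a1 *m a1 = 1%:M -> U *m U = 1%:M ->
  1%:M *t (r0 + r1) + a0 *t (r0 - r1) = U *+ 2 ->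
  1%:M *t (r0 + r1) + a1 *t (r0 - r1) = - U *+ 2 ->
  [/\ a1 = - a0, r1 = - r0 & U = a0 *t r0].
Proof.
move=> mq aa0 aa1 UU e0 e1; have nU := sqr1_neq0 mq UU.
have [m0 q0] : (0 < m)%N /\ (0 < q)%N by apply/andP; rewrite -muln_gt0.
have U2 : U *+ 2 = - U *+ 2 -> False.
  move=> /eqP; rewrite -subr_eq0 mulNrn opprK -mulrnDr -scaler_nat.
  by rewrite scaler_eq0 pnatr_eq0 (negPf nU).
have : (a0 + a1) *t (r0 - r1) = 1%:M *t (- ((r0 + r1) *+ 2)).
  have e := congr2 +%R e0 e1.
  rewrite mulNrn subrr addrACA in e.
  rewrite -scaler_nat -scaleNr tensmxZr scaleNr scaler_nat mulr2n tensmxDl.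
  by apply/eqP; rewrite -addr_eq0 addrC e.
case/tens_eq_scalar => [r01|[a ea]].
  by case: U2; rewrite -e0 -e1 r01 !mxtens.tensmx0.
have [a00|na] := eqVneq a 0.
  have ea1 : a1 = - a0.
    by apply/eqP; rewrite -addr_eq0 addrC ea a00 raddf0.
  have er : 1%:M *t (r0 + r1) = 0 :> 'M[C]_(m * q).
    have e := congr2 +%R e0 e1.
    rewrite mulNrn subrr ea1 -[- a0]scaleN1r tensmxZl scaleN1r addrACA subrr addr0 in e.
    move/eqP: e; rewrite -mulr2n -scaler_nat scaler_eq0 pnatr_eq0 /= => /eqP e.
    exact: e.
  have r10 : r1 = - r0.
    case: (tensmx_eq0 er) => [/eqP|/eqP]; last by rewrite addrC addr_eq0 => /eqP.
    by rewrite (negPf (scalarmx_neq0 _ _)) // oner_eq0.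
  split=> //; apply/eqP; rewrite -subr_eq0.
  have : 2%:R *: (U - a0 *t r0) = 0.
    rewrite scalerBr scaler_nat -e0 er add0r r10 opprK tensmxDr scaler_nat.
    by rewrite mulr2n subrr.
  by move/eqP; rewrite scaler_eq0 pnatr_eq0.
(* Since (a0 + a1) a0 and a1 (a0 + a1) both equal 1 + a1 a0, a nonzero scalar sum forces a0 = a1. *)
case: U2; suff a01 : a0 = a1 by rewrite -e0 -e1 a01.
apply: (scalerI na); rewrite -!mul_scalar_mx -[RHS]scalar_mxC -ea.
by rewrite mulmxDl mulmxDr aa0 aa1 addrC.
Qed.

End Factor.

(** * Nondegeneracy and the exclusion of anticommuting symmetries *)

Section Nondegenerate.
Variable C : numClosedFieldType.

(** [o] selects which of the two hypotheses of the theorem is in force: odd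
    multiplicity, or nonzero action on [H_1] (which is [\tr (u *m w)]). *)
Definition nondeg (o : bool) m (u w : 'M[C]_m) :=
  if o then odd m else \tr (u *m w) != 0.

Lemma nondeg_gt0 o m (u w : 'M[C]_m) : nondeg o u w -> (0 < m)%N.
Proof.
case: m u w => // u w; case: o => [//|].
by rewrite /nondeg /mxtrace big_ord0 eqxx.
Qed.

Lemma nondeg_tens o m q (u w : 'M[C]_m) (u' w' : 'M[C]_q) :
  nondeg o u w -> nondeg o u' w' -> nondeg o (u *t u') (w *t w').
Proof.
case: o; rewrite /nondeg; first by rewrite oddM => -> ->.
by move=> uw uw'; rewrite mxtens.tensmx_mul mxtrace_tens mulf_neq0.
Qed.

(** For odd m, taking determinants would give det u det w = - det w det u, while both determinants
    are nonzero. *)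
Lemma anticomm_odd m (u w : 'M[C]_m) :
  u *m u = 1%:M -> w *m w = 1%:M -> u *m w = - (w *m u) -> ~~ odd m.
Proof.
move=> uu ww uw; apply/negP => om.
have nd (a : 'M[C]_m) : a *m a = 1%:M -> \det a != 0.
  move=> aa; apply: contra_eq_neq (congr1 determinant aa) => a0.
  by rewrite det_mulmx a0 mul0r det1 eq_sym oner_eq0.
have /eqP := congr1 determinant uw; rewrite -scaleN1r detZ !det_mulmx -signr_odd om.
rewrite expr1 mulN1r mulrC -addr_eq0 -mulr2n -mulr_natl mulf_eq0 pnatr_eq0 /=.
by rewrite mulf_eq0 (negPf (nd _ uu)) (negPf (nd _ ww)).
Qed.

(* Two tensor products of symmetries commute iff the factors both commute or
   both anticommute; the second case is what nondegeneracy excludes. *)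
Lemma tens_sym_comm o m q (u w : 'M[C]_m) (u' w' : 'M[C]_q) :
  u *m u = 1%:M -> w *m w = 1%:M -> u' *m u' = 1%:M -> w' *m w' = 1%:M ->
  (u *t u') *m (w *t w') = (w *t w') *m (u *t u') ->
  nondeg o (u *t u') (w *t w') -> u *m w = w *m u.
Proof.
move=> uu ww uu' ww' cm nd.
have [m0 q0] : (0 < m)%N /\ (0 < q)%N.
  by apply/andP; rewrite -muln_gt0; apply: nondeg_gt0 nd.
rewrite !mxtens.tensmx_mul in cm.
(* Commutation of the tensor products gives (u w)^2 (x) 1 = 1 (x) (w' u')^2, so (u w)^2 is a scalar
   [a]; then u w = a w u and w u = a u w, whence a^2 = 1. *)
have [a ea] : exists a : C, u *m w *m (u *m w) = a%:M.
  have e : (u *m w *m (u *m w)) *t 1%:M = 1%:M *t (w' *m u' *m (w' *m u')).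
    have e1 : (u *m w *t 1%:M) = (w *m u) *t (w' *m u' *m (w' *m u')).
      have := congr1 (mulmx (1%:M *t (w' *m u'))) cm.
      rewrite !mxtens.tensmx_mul !mul1mx => <-; congr (_ *t _).
      by rewrite mulmxA -(mulmxA w') uu' mulmx1 ww'.
    have := congr1 (mulmx ((u *m w) *t 1%:M)) e1.
    rewrite !mxtens.tensmx_mul !mul1mx => ->; congr (_ *t _).
    by rewrite mulmxA -(mulmxA u) ww mulmx1 uu.
  case: (tens_eq_scalar e) => // /eqP.
  by rewrite (negPf (scalarmx_neq0 _ _)) // oner_eq0.
have ew : u *m w = a *: (w *m u).
  rewrite -mul_scalar_mx -ea -!mulmxA (mulmxA w w) ww mul1mx uu mulmx1.
  by [].
have eu : w *m u = a *: (u *m w).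
  have := congr1 (fun M => u *m M *m u) ew.
  rewrite /= -scalemxAr -scalemxAl mulmxA uu mul1mx => ->.
  by rewrite -!mulmxA uu mulmx1.
have aa : a * a = 1.
  have /eqP : (1 - a * a) *: (u *m w) = 0.
    by rewrite scalerBl scale1r -scalerA -eu -ew subrr.
  rewrite scaler_eq0 subr_eq0 => /orP [/eqP //|/eqP uw0].
  have := sqr1_neq0 m0 ww; rewrite -[w]mul1mx -uu -mulmxA uw0 mulmx0 eqxx.
  by [].
have /orP [/eqP a1|/eqP aN1] : (a == 1) || (a == -1) by rewrite -eqf_sqr expr1n expr2 aa.
  by rewrite ew a1 scale1r.
(* Anticommuting u, w make m even and, by cyclicity, give tr(u w) = 0; either contradicts
   nondegeneracy of the tensor product. *)
move: nd; rewrite aN1 scaleN1r in ew; case: o; rewrite /nondeg.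
  by rewrite oddM (negPf (anticomm_odd uu ww ew)).
rewrite mxtens.tensmx_mul mxtrace_tens mulf_eq0 negb_or => /andP [/negP []].
have /eqP := congr1 mxtrace ew; rewrite raddfN /= -(mxtrace_mulC u w).
by rewrite -addr_eq0 -mulr2n -mulr_natl mulf_eq0 pnatr_eq0.
Qed.

Lemma symfam_sqr r n m b c (v : 'I_r -> 'M[C]_(n, m)) u w :
  (forall i, exists x, b x = i) -> symfam b c v u w ->
  u *m u = 1%:M /\ w *m w = 1%:M.
Proof.
move=> sb [iv cv sv].
have key x : (if upper (b x) then u else w) *m (if upper (b x) then u else w) = 1%:M.
  set a := if _ then _ else _.
  have : diagfun_mx (@sgn C \o c) *m (diagfun_mx (@sgn C \o c) *m v x) = v x *m (a *m a).
    rewrite sv -/a -scalemxAr.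
    rewrite [diagfun_mx _ *m (_ *m _)]mulmxA sv -scalemxAl scalerA sgn_sqr scale1r.
    by rewrite mulmxA.
  have -> : diagfun_mx (@sgn C \o c) *m (diagfun_mx (@sgn C \o c) *m v x) = v x.
    by apply/matrixP => i j; rewrite !diagfun_mulE mulrA sgn_sqr mul1r.
  by move/(congr1 (mulmx ((v x) ^t*))); rewrite mulmxA iv eqxx mul1mx.
have [x0 b0] := sb 0; have [x2 b2] := sb 2%:R.
by have := key x0; have := key x2; rewrite b0 b2.
Qed.

(** Conjugation by the unitary between the two multiplicity spaces preserves commutation, dimension
    and trace. *)
Lemma symfam_change o r n m m' b c (v : 'I_r -> 'M[C]_(n, m)) u w
    (v' : 'I_r -> 'M[C]_(n, m')) (x0 : 'I_r) :
  symfam b c v u w -> u *m w = w *m u -> nondeg o u w ->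
  isofam v' -> famhom v =1 famhom v' ->
  exists u' w', [/\ symfam b c v' u' w', u' *m w' = w' *m u' & nondeg o u' w'].
Proof.
move=> sf uw nd iv' ev; have [iv _ _] := sf.
have [vc cc cc'] := isofam_change x0 iv' iv (fsym ev).
move: (_ *m _) vc cc cc' => h vc cc cc'.
exists (h ^t* *m u *m h), (h ^t* *m w *m h).
have hM A B : h ^t* *m A *m h *m (h ^t* *m B *m h) = h ^t* *m (A *m B) *m h.
  by rewrite !mulmxA -(mulmxA _ h) cc' mulmx1.
split; first exact: symfam_conj sf iv' vc cc'.
  by rewrite !hM uw.
move: nd; rewrite /nondeg; case: (o) => [|]; last first.
  rewrite hM [\tr (_ *m h)]mxtrace_mulC.
  by rewrite (mulmxA h) cc' mul1mx.
suff -> : m = m' by [].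
by apply/eqP; rewrite eqn_leq (mulmx1_min cc') (mulmx1_min cc).
Qed.

End Nondegenerate.

(** * Extraction of the symmetries of the first factor *)

Section FactorThm.
Variable C : numClosedFieldType.
Variables (r n p m q : nat).
Variables (b : 'I_r -> 'I_4) (c : 'I_n -> 'I_4) (d : 'I_p -> 'I_4).
Variables (v : 'I_r -> 'M[C]_(n, m)) (w : 'I_n -> 'M[C]_(p, q)).
Hypotheses (iv : isofam v) (bv : block_hom b c v).
Hypotheses (iw : isofam w) (bw : block_hom c d w).
Hypotheses (sb : forall i, exists x, b x = i) (sc : forall i, exists x, c x = i).
Variables U W : 'M[C]_(m * q).
Hypothesis sT : symfam b d (fun x => famcomp (v x) w) U W.
Hypothesis cv : forall x y k, v x y k != 0 -> upper (c y) = upper (b x).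

Let J := diagfun_mx (@sgn C \o c).
Let J' := diagfun_mx (@sgn C \o d).

(** Here y0 and y1 represent the two blocks on the side of x. For y in either of them, J' w_y is w_y
    r0 or w_y r1 according to the sign of y, so 2 J' w_y = w_y (r0 + r1) + sgn(c y) w_y (r0 - r1).
    Summing against v_x and compressing by the composite isometry gives the identity. *)
Lemma factor_eq x y0 y1 : c y0 = (if upper (b x) then 0 else 2%:R) ->
  c y1 = (if upper (b x) then 1 else 3%:R) ->
  let r0 := (w y0) ^t* *m J' *m w y0 in let r1 := (w y1) ^t* *m J' *m w y1 in
  1%:M *t (r0 + r1) + ((v x) ^t* *m J *m v x) *t (r0 - r1) =
  sgn C (b x) *: (if upper (b x) then U else W) *+ 2.
Proof.
move=> c0 c1 r0 r1; have [it _ /(_ x) jt] := sT.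
have e : famcomp (v x) (fun y => J' *m w y) *+ 2 =
    famcomp (v x) (fun y => w y *m (r0 + r1)) +
    famcomp (v x) (fun y => sgn C (c y) *: (w y *m (r0 - r1))).
  rewrite -scaler_nat; apply: mx_tpairrP => z k s.
  rewrite [LHS]mxE [RHS]mxE !famcompE mulr_sumr -big_split /=.
  apply: eq_bigr => y _; have [->|nz] := eqVneq (v x y k) 0.
    by rewrite !mul0r mulr0 addr0.
  rewrite mulrCA -mulrDr; congr (_ * _).
  transitivity ((w y *m (r0 + r1) + sgn C (c y) *: (w y *m (r0 - r1))) z s);
    last by rewrite mxE.
  transitivity ((2%:R *: (J' *m w y)) z s); first by rewrite [RHS]mxE.
  congr (_ z s).
  have ry y' : c y = c y' -> J' *m w y = w y *m ((w y') ^t* *m J' *m w y').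
    exact: block_hom_dgE.
  have uc := cv nz.
  have [yc|yc] : c y = c y0 \/ c y = c y1.
  - rewrite c0 c1 -uc; move: (c y); rewrite /upper.
    by case=> [[|[|[|[|]]]] //] ?; [left|right|left|right]; apply: val_inj.
  - have -> : sgn C (c y) = 1.
      by rewrite yc c0 /sgn; case: ifP => _; rewrite ?expr0 // exprS expr1 mulrNN mulr1.
    by rewrite (ry _ yc) -/r0 scale1r -mulmxDr addrACA subrr addr0 -mulr2n
               -scaler_nat scalemxAr.
  have -> : sgn C (c y) = -1.
    by rewrite yc c1 /sgn; case: ifP => _; rewrite ?expr1 // !exprS expr0; ring.
  by rewrite (ry _ yc) -/r1 scaleN1r -mulmxN opprB -mulmxDr [r0 + r1]addrC
             addrACA subrr addr0 -mulr2n -scaler_nat scalemxAr.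
rewrite -famcomp_lmul jt -(famcomp_dg _ (v x) (fun y => w y *m (r0 - r1))) in e.
rewrite (block_hom_dgE iv bv (@sgn C) (erefl (b x))) famcompMl in e.
rewrite -{2}[v x]mulmx1 famcompMl in e.
have := congr1 (mulmx ((famcomp (v x) w) ^t*)) e.
rewrite -mulmxDr mulmxA it eqxx mul1mx => <-.
by rewrite -[in LHS]scaler_nat -!scalemxAr mulmxA it eqxx mul1mx scaler_nat.
Qed.

(** The symmetries are the compressions of the sign matrix at representatives of blocks 1 and 3; by
    [tens_sym_split] those at blocks 2 and 4 are their negatives. *)
Lemma factor_symfam o : U *m W = W *m U -> nondeg o U W ->
  exists u u', symfam b c v u u' /\ u *m u' = u' *m u.
Proof.
move=> UW nd; have [UU WW] := symfam_sqr sb sT; have mq := nondeg_gt0 nd.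
have [x0 b0] := sb 0; have [x1 b1] := sb 1.
have [x2 b2] := sb 2%:R; have [x3 b3] := sb 3%:R.
have [y0 c0] := sc 0; have [y1 c1] := sc 1.
have [y2 c2] := sc 2%:R; have [y3 c3] := sc 3%:R.
have f0 := @factor_eq x0 y0 y1; rewrite b0 in f0; have {f0} /= f0 := f0 c0 c1.
have f1 := @factor_eq x1 y0 y1; rewrite b1 in f1; have {f1} /= f1 := f1 c0 c1.
have f2 := @factor_eq x2 y2 y3; rewrite b2 in f2; have {f2} /= f2 := f2 c2 c3.
have f3 := @factor_eq x3 y2 y3; rewrite b3 in f3; have {f3} /= f3 := f3 c2 c3.
have s0 : sgn C 0 = 1 by [].
have s1 : sgn C 1 = -1 by rewrite /sgn expr1.
have s2 : sgn C 2%:R = 1 by rewrite /sgn exprS expr1 mulrNN mulr1.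
have s3 : sgn C 3%:R = -1 by rewrite /sgn !exprS expr0; ring.
rewrite s0 scale1r in f0; rewrite s1 scaleN1r in f1.
rewrite s2 scale1r in f2; rewrite s3 scaleN1r in f3.
have av := block_hom_sym iv bv; have aw := block_hom_sym iw bw.
have [a10 r10 eU] := tens_sym_split mq (av x0) (av x1) UU f0 f1.
have [a32 r32 eW] := tens_sym_split mq (av x2) (av x3) WW f2 f3.
exists ((v x0) ^t* *m J *m v x0), ((v x2) ^t* *m J *m v x2); split; last first.
  rewrite eU eW in UW nd.
  exact: tens_sym_comm (av x0) (av x2) (aw y0) (aw y2) UW nd.
split=> // x; have [i bi] : exists i, b x = i by exists (b x).
have ja := block_hom_dgE iv bv (@sgn C).
case: i bi => [[|[|[|[|]]]] //] ? bi.
- have e : b x = b x0 by rewrite bi b0; apply: val_inj.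
  by rewrite (ja _ _ e) e b0 s0 scale1r.
- have e : b x = b x1 by rewrite bi b1; apply: val_inj.
  by rewrite (ja _ _ e) e b1 s1 a10 scaleN1r mulmxN.
- have e : b x = b x2 by rewrite bi b2; apply: val_inj.
  by rewrite (ja _ _ e) e b2 s2 scale1r.
have e : b x = b x3 by rewrite bi b3; apply: val_inj.
by rewrite (ja _ _ e) e b3 s3 a32 scaleN1r mulmxN.
Qed.

End FactorThm.

(** * Simultaneous diagonalization of the two symmetries *)

Section Diagonalize.
Variable C : numClosedFieldType.

Lemma symfam_herm r n m b c (v : 'I_r -> 'M[C]_(n, m)) u w :
  (forall i, exists x, b x = i) -> symfam b c v u w -> u ^t* = u /\ w ^t* = w.
Proof.
move=> sb [iv _ sv].
have key x : (if upper (b x) then u else w) ^t* = (if upper (b x) then u else w).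
  set a := if _ then _ else _.
  have ea : a = sgn C (b x) *: ((v x) ^t* *m diagfun_mx (@sgn C \o c) *m v x).
    by rewrite -mulmxA sv -scalemxAr scalerA sgn_sqr scale1r mulmxA iv eqxx mul1mx.
  rewrite ea adjmxZ sgn_conj !adjmxM trmxCK mulmxA diagfun_adj // => z.
  exact: sgn_conj.
have [x0 b0] := sb 0; have [x2 b2] := sb 2%:R.
by have := key x0; have := key x2; rewrite b0 b2.
Qed.

(** Commuting matrices are simultaneously trigonalized by a unitary, and a hermitian triangular
    matrix is diagonal. *)
Lemma symfam_diag r n m b c (v : 'I_r -> 'M[C]_(n, m)) u w :
  (forall i, exists x, b x = i) -> symfam b c v u w -> u *m w = w *m u ->
  exists (v' : 'I_r -> 'M[C]_(n, m)) (e f : 'I_m -> C),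
    symfam b c v' (diagfun_mx e) (diagfun_mx f) /\ famhom v =1 famhom v'.
Proof.
move=> sb sf uw; have [uh wh] := symfam_herm sb sf; have [iv _ _] := sf.
have [P Pu [/= Tu Tw]] : exists2 P : 'M[C]_m, P \is unitarymx &
    is_trig_mx (P *m u *m P ^t*) /\ is_trig_mx (P *m w *m P ^t*).
  have [P Pu] := cotrigonalization2 uw.
  by rewrite /similar_to !conjymx // => /andP [? ?]; exists P.
have dgP a : a ^t* = a -> is_trig_mx (P *m a *m P ^t*) ->
    P *m a *m P ^t* = diagfun_mx (fun k => (P *m a *m P ^t*) k k).
  move=> ah; have : (P *m a *m P ^t*) ^t* = P *m a *m P ^t*.
    by rewrite !adjmxM trmxCK ah mulmxA.
  move: (_ *m _ ^t*) => M hM ta.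
  apply/matrixP => i j; rewrite !mxE; case: eqVneq => [->|nij].
    by rewrite mulr1n.
  rewrite mulr0n; case: (ltngtP i j) => [ij|ji|/val_inj e].
  - by have /is_trig_mxP := ta; apply.
  - by rewrite -hM adjmxE (is_trig_mxP ta) ?conjC0.
  by rewrite e eqxx in nij.
have PP : P *m P ^t* = 1%:M by apply/unitarymxP.
have PP' : P ^t* *m P = 1%:M by apply: mulmx1C.
exists (fun x => v x *m P ^t*), (fun k => (P *m u *m P ^t*) k k),
  (fun k => (P *m w *m P ^t*) k k); split.
  rewrite -(dgP u) // -(dgP w) //.
  have iv' : isofam (fun x => v x *m P ^t*).
    move=> x y; rewrite adjmxM trmxCK mulmxA -(mulmxA P) iv.
    by case: eqP => _; rewrite ?mulmx1 ?PP // raddf0 mulmx0 mul0mx.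
  have := symfam_conj sf iv' (fun x => erefl (v x *m P ^t*)).
  by rewrite trmxCK; apply.
move=> a; apply: eq_bigr => x _; apply: eq_bigr => y _.
by rewrite adjmxM trmxCK mulmxA -(mulmxA (v x)) PP' mulmx1.
Qed.

End Diagonalize.

(** * Uniqueness of the extension; decomposition into columns *)

Section FamEq.
Variable C : numClosedFieldType.

(** The corner from blocks 1, 2 to blocks 3, 4 generates the full matrix algebra as a star algebra:
    adjoints give the opposite corner, and a unit within one side factors through an index of the
    other side. *)
Lemma famhom_eq r n m m' (b : 'I_r -> 'I_4) (v : 'I_r -> 'M[C]_(n, m))
    (v' : 'I_r -> 'M[C]_(n, m')) :
  (forall i, exists x, b x = i) -> isofam v -> isofam v' ->
  (forall x y, fcsupp (b x) (b y) -> v x *m (v y) ^t* = v' x *m (v' y) ^t*) ->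
  famhom v =1 famhom v'.
Proof.
move=> sb iv iv' h a; apply: eq_bigr => x _; apply: eq_bigr => y _; congr (_ *: _).
have up x1 y1 : upper (b x1) -> ~~ upper (b y1) ->
    v x1 *m (v y1) ^t* = v' x1 *m (v' y1) ^t*.
  by move=> ux uy; apply: h; apply: fcsupp_upper.
have dn x1 y1 : upper (b x1) -> ~~ upper (b y1) ->
    v y1 *m (v x1) ^t* = v' y1 *m (v' x1) ^t*.
  move=> ux uy; have := congr1 (fun M => M ^t*) (up _ _ ux uy).
  by rewrite /= !adjmxM !trmxCK.
have via z m1 (v1 : 'I_r -> 'M[C]_(n, m1)) : isofam v1 ->
    v1 x *m (v1 y) ^t* = v1 x *m (v1 z) ^t* *m (v1 z *m (v1 y) ^t*).
  by move=> iv1; rewrite mulmxA -(mulmxA _ _ (v1 z)) iv1 eqxx mulmx1.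
have [x0 b0] := sb 0; have [x2 b2] := sb 2%:R.
have [u0 u2] : upper (b x0) /\ ~~ upper (b x2) by rewrite b0 b2.
case: (boolP (upper (b x))) => ux; case: (boolP (upper (b y))) => uy.
- by rewrite (via x2) // up // dn // -via.
- exact: up.
- exact: dn.
by rewrite (via x0) // dn // up // -via.
Qed.

(** The same array sliced the other way: [famcol v k] embeds C^r as the k-th copy in the
    multiplicity decomposition. *)
Definition famcol r n m (v : 'I_r -> 'M[C]_(n, m)) (k : 'I_m) : 'M[C]_(n, r) :=
  \matrix_(z, x) v x z k.

Lemma famhom_colE r n m (v : 'I_r -> 'M[C]_(n, m)) a :
  famhom v a = \sum_k famcol v k *m a *m (famcol v k) ^t*.
Proof.
apply/matrixP => z t; rewrite !summxE.
transitivity (\sum_x \sum_y \sum_k v x z k * a x y * (v y t k)^*).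
  apply: eq_bigr => x _; rewrite summxE; apply: eq_bigr => y _.
  rewrite !mxE mulr_sumr; apply: eq_bigr => k _.
  by rewrite adjmxE mulrCA mulrA.
under eq_bigr do rewrite exchange_big /=.
rewrite exchange_big /=; apply: eq_bigr => k _.
rewrite exchange_big /= mxE; apply: eq_bigr => y _.
rewrite adjmxE !mxE mulr_suml; apply: eq_bigr => x _.
by rewrite !mxE.
Qed.

Lemma famcol_orth r n m (v : 'I_r -> 'M[C]_(n, m)) k l : isofam v ->
  (famcol v k) ^t* *m famcol v l = (k == l)%:R%:M.
Proof.
move=> iv; apply/matrixP => x y; have /matrixP/(_ k l) := iv x y.
rewrite !mxE => e; transitivity ((x == y)%:R *+ (k == l) : C).
  by rewrite -e; apply: eq_bigr => z _; rewrite !mxE.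
by case: (x == y); case: (k == l).
Qed.

Lemma isofam_col r n m (v : 'I_r -> 'M[C]_(n, m)) :
  (forall k l, (famcol v k) ^t* *m famcol v l = (k == l)%:R%:M) -> isofam v.
Proof.
move=> h x y; apply/matrixP => k l; have /matrixP/(_ x y) := h k l.
rewrite !mxE => e; transitivity ((k == l)%:R *+ (x == y) : C).
  by rewrite -e; apply: eq_bigr => z _; rewrite !mxE.
by case: (x == y); case: (k == l).
Qed.

Lemma famhom_coef r n m (v : 'I_r -> 'M[C]_(n, m)) a x y : isofam v ->
  (v x) ^t* *m famhom v a *m v y = (a x y)%:M.
Proof.
move=> iv; have e z : (v z) ^t* *m v z = 1%:M by rewrite iv eqxx.
rewrite -[LHS]mulmx1 -(e y) -[LHS]mul1mx -[in LHS](e x).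
have -> : (v x) ^t* *m v x *m ((v x) ^t* *m famhom v a *m v y *m ((v y) ^t* *m v y)) =
  (v x) ^t* *m (famhom v (delta_mx x x) *m famhom v a *m famhom v (delta_mx y y)) *m v y.
  by rewrite !famhom_delta !mulmxA.
rewrite -!famhomM //.
have -> : delta_mx x x *m a *m delta_mx y y = a x y *: delta_mx x y.
  apply/matrixP => i j; rewrite mxE (bigD1 y) //= big1 => [|k /negPf nk]; last first.
    by rewrite !mxE nk mulr0.
  rewrite !mxE (bigD1 x) //= big1 => [|k /negPf nk]; last by rewrite !mxE nk andbF mul0r.
  by rewrite !mxE !eqxx andbT addr0; case: (i == x); case: (j == y);
     rewrite /= ?(mulr1, mulr0, mul1r, mul0r, addr0).
rewrite linearZ /= famhom_delta -scalemxAr -scalemxAl !mulmxA e mul1mx e.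
by rewrite scale_scalar_mx mulr1.
Qed.

Lemma famhom_inj r n m (v : 'I_r -> 'M[C]_(n, m)) : (0 < m)%N -> isofam v ->
  injective (famhom v).
Proof.
move=> m0 iv a a' e; apply/eqP; rewrite -subr_eq0; apply/eqP/matrixP => x y.
have := famhom_coef (a - a') x y iv; rewrite linearB /= e subrr mulmx0 mul0mx.
move=> /esym/eqP; rewrite [RHS]mxE; apply: contraTeq.
exact: scalarmx_neq0.
Qed.

End FamEq.

(** * The four rigid types and their signs *)

Section Types.
Variable C : numClosedFieldType.

Lemma ord4P (i : 'I_4) : [\/ i = 0, i = 1, i = 2%:R | i = 3%:R].
Proof.
by case: i => [[|[|[|[|]]]] //] ?;
  [constructor 1|constructor 2|constructor 3|constructor 4]; apply: val_inj.
Qed.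

Lemma sgn4 : [/\ sgn C 0 = 1, sgn C 1 = -1, sgn C 2%:R = 1 & sgn C 3%:R = -1].
Proof. by split; rewrite /sgn ?expr0 ?expr1 // !exprS expr0; ring. Qed.

Lemma fctype_cases (t : 'S_4) : fctype t ->
  ((t 0 = 0 /\ t 1 = 1) \/ (t 0 = 1 /\ t 1 = 0)) /\
  ((t 2%:R = 2%:R /\ t 3%:R = 3%:R) \/ (t 2%:R = 3%:R /\ t 3%:R = 2%:R)).
Proof.
move=> ft; have ne i j : i != j -> t i != t j by rewrite (inj_eq perm_inj).
split.
  have := ne 0 1 isT; have := ft 0; have := ft 1.
  by case: (ord4P (t 0)) => ->; case: (ord4P (t 1)) => -> //; [left|right].
have := ne 2%:R 3%:R isT; have := ft 2%:R; have := ft 3%:R.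
by case: (ord4P (t 2%:R)) => ->; case: (ord4P (t 3%:R)) => -> //; [left|right].
Qed.

(** On each side the type fixes or swaps the two blocks, so it multiplies the sign by a constant,
    read at the first block of that side. *)
Lemma fctype_sgn (t : 'S_4) i : fctype t ->
  sgn C (t i) = sgn C i * (if upper i then sgn C (t 0) else sgn C (t 2%:R)).
Proof.
have [s0 s1 s2 s3] := sgn4.
move=> /fctype_cases [[] [e0 e1] [] [e2 e3]]; case: (ord4P i) => ->;
  rewrite /upper /= ?(e0, e1, e2, e3) ?(s0, s1, s2, s3); ring.
Qed.

(** The contribution of one summand to H_1 is thus a diagonal entry of u w, which turns H_1 into a
    trace. *)
Lemma fctype_h1 (t : 'S_4) : fctype t ->
  sgn C (t 0) * sgn C (t 2%:R) =
  (t \in [:: 1%g; (t12 * t34)%g])%:R - (t \in [:: t12; t34])%:R.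
Proof.
move=> ft; have [s0 s1 s2 s3] := sgn4.
have n1 : (1 : C) <> -1.
  by move=> /eqP; rewrite -subr_eq0 opprK (pnatr_eq0 C 2).
have v12 : [/\ t12 0 = 1, t12 1 = 0, t12 2%:R = 2%:R & t12 3%:R = 3%:R].
  by rewrite /t12 tpermL tpermR !tpermD.
have v34 : [/\ t34 0 = 0, t34 1 = 1, t34 2%:R = 3%:R & t34 3%:R = 2%:R].
  by rewrite /t34 tpermL tpermR !tpermD.
have [a0 a1 a2 a3] := v12; have [b0 b1 b2 b3] := v34.
have L1 : t \in [:: 1%g; (t12 * t34)%g] -> sgn C (t 0) * sgn C (t 2%:R) = 1.
  rewrite !inE => /orP [] /eqP ->; rewrite ?permM ?perm1 ?a0 ?a2 ?b1 ?b2 ?s0 ?s1 ?s2 ?s3;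
  ring.
have L2 : t \in [:: t12; t34] -> sgn C (t 0) * sgn C (t 2%:R) = -1.
  rewrite !inE => /orP [] /eqP ->; rewrite ?a0 ?a2 ?b0 ?b2 ?s0 ?s1 ?s2 ?s3; ring.
have : (t \in [:: 1%g; (t12 * t34)%g]) || (t \in [:: t12; t34]).
  have eqt (t' : 'S_4) : t 0 = t' 0 -> t 1 = t' 1 -> t 2%:R = t' 2%:R ->
      t 3%:R = t' 3%:R -> t = t'.
    by move=> *; apply/permP => i; case: (ord4P i) => ->.
  rewrite !inE; have [[] [e0 e1] [] [e2 e3]] := fctype_cases ft.
  - by rewrite (eqt 1%g) ?perm1 // eqxx.
  - by rewrite (eqt t34) ?eqxx ?orbT // (b0, b1, b2, b3).
  - by rewrite (eqt t12) ?eqxx ?orbT // (a0, a1, a2, a3).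
  by rewrite (eqt (t12 * t34)%g) ?eqxx ?orbT // permM (a0, a1, a2, a3) (b0, b1, b2, b3).
case: (boolP (_ \in _)) L1 => h1 L1; case: (boolP (_ \in [:: t12; t34])) L2 => h2 L2 // _.
- by case: n1; rewrite -[LHS](L1 isT) (L2 isT).
- by rewrite L1 // subr0.
by rewrite L2 // sub0r.
Qed.

End Types.

(** * 4-cycle algebras *)

Section FourCycle.
Variable R : realType.
Implicit Types A B D : fcblocks.

Definition blockidx A (x : 'I_(\sum_(i < 4) bsize A i)) : 'I_4 := tagnat.sig1 x.

Lemma blockidx_surj A i : exists x, @blockidx A x = i.
Proof.
by exists (tagnat.Rank i (Ordinal (bsize_gt0 A i))); rewrite /blockidx tagnat.Rank1K.
Qed.

Lemma fcpred_entryP A (a : fcmat R A) :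
  reflect (forall x y, ~~ fcsupp (blockidx x) (blockidx y) -> a x y = 0)
    (a \in fcpred R A).
Proof.
apply: (iffP (fcpredP a)) => [h x y nxy|h i j nij].
  have /matrixP/(_ (tagnat.sig2 x) (tagnat.sig2 y)) := h _ _ nxy.
  by rewrite !mxE !tagnat.sig2K.
by apply/matrixP => s t; rewrite !mxE; apply: h; rewrite /blockidx !tagnat.Rank1K.
Qed.

Lemma fcpred_delta A (x y : 'I_(\sum_(i < 4) bsize A i)) :
  fcsupp (blockidx x) (blockidx y) -> delta_mx x y \in fcpred R A.
Proof.
move=> sxy; apply/fcpred_entryP => z t; rewrite mxE.
by have [->|//] := eqVneq z x; have [->|//] := eqVneq t y; rewrite sxy.
Qed.

Lemma fcval_blockproj A i :
  fcval (blockproj R A i) = diagfun_mx (fun x => (blockidx x == i)%:R).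
Proof.
apply/mxblockP => k l; rewrite mxblockK; apply/matrixP => s t.
rewrite !mxE /blockidx tagnat.Rank1K.
case: eqVneq => [e|nkl].
  case: _ / e s t => s t; rewrite conform_mx_id !mxE.
  by rewrite (inj_eq (can_inj (@tagnat.rankK _ _))) eq_Tagged.
have nR : tagnat.Rank k s != tagnat.Rank l t.
  by apply: contra_neq nkl => /(congr1 (@tagnat.sig1 _ _)); rewrite !tagnat.Rank1K.
by rewrite mxE (negPf nR) mulr0n.
Qed.

Lemma fcval_inj A : injective (@fcval R A).
Proof. exact: val_inj. Qed.

Lemma fcvalM A (a b : fcalg R A) : fcval (a * b) = fcval a *m fcval b.
Proof. by []. Qed.

Lemma fcval1 A : fcval (1 : fcalg R A) = 1%:M.
Proof. by []. Qed.

Lemma fcval0 A : fcval (0 : fcalg R A) = 0.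
Proof. by []. Qed.

Lemma fcval_sum A N (a : 'I_N -> fcalg R A) : fcval (\sum_k a k) = \sum_k fcval (a k).
Proof. exact: (raddf_sum (\val : fcalg R A -> fcmat R A)). Qed.

Definition fam_of A B m (v : 'I_(\sum_(i < 4) bsize A i) ->
    'M[R[i]]_(\sum_(i < 4) bsize B i, m)) (f : fcalg R A -> fcalg R B) :=
  isofam v /\ forall a, fcval (f a) = famhom v (fcval a).

Lemma fam_of_delta A B m v (f : fcalg R A -> fcalg R B) x y :
  @fam_of A B m v f -> fcsupp (blockidx x) (blockidx y) ->
  exists a : fcalg R A, fcval (f a) = v x *m (v y) ^t*.
Proof.
by move=> [_ vf] sxy; exists (FCAlg (fcpred_delta sxy)); rewrite vf /= famhom_delta.
Qed.

Lemma fam_of_block A B m v (f : fcalg R A -> fcalg R B) :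
  @fam_of A B m v f -> block_hom (@blockidx A) (@blockidx B) v.
Proof.
move=> vf x y z t sxy; have [a <-] := fam_of_delta vf sxy.
by apply: contraNT => nzt; have /fcpred_entryP/(_ z t nzt)/eqP := valP (f a).
Qed.

Lemma star_extendible_fam A B (f : fcalg R A -> fcalg R B) :
  star_extendible f -> exists m v, @fam_of A B m v f.
Proof.
move=> [_ [F [[lF mF sF] eF]]]; have [x0 _] := blockidx_surj A 0.
have [m [v [iv Fv]]] := star_hom_famhom x0 lF mF sF.
by exists m, v; split=> // a; rewrite -eF Fv.
Qed.

Lemma fam_of_comp A B D m q v w (f : fcalg R A -> fcalg R B)
    (g : fcalg R B -> fcalg R D) :
  @fam_of A B m v f -> @fam_of B D q w g ->
  fam_of (fun x => famcomp (v x) w) (g \o f).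
Proof.
move=> [iv vf] [iw wg]; split; first exact: isofam_famcomp.
by move=> a; rewrite /= wg vf famhom_comp.
Qed.

Lemma fam_of_eq A B m m' v v' (f : fcalg R A -> fcalg R B) :
  @fam_of A B m v f -> @fam_of A B m' v' f -> famhom v =1 famhom v'.
Proof.
move=> [iv vf] [iv' vf']; apply: (famhom_eq (@blockidx_surj A)) => // x y sxy.
by rewrite -!famhom_delta -(vf (FCAlg (fcpred_delta sxy)))
           -(vf' (FCAlg (fcpred_delta sxy))).
Qed.

Lemma famhom_star_hom A B m
    (v : 'I_(\sum_(i < 4) bsize A i) -> 'M[R[i]]_(\sum_(i < 4) bsize B i, m)) :
  isofam v -> star_hom (R := R) (A := A) (B := B) (famhom v).
Proof.
by split; [exact: famhom_is_linear | exact: famhomM | exact: famhom_adj].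
Qed.

Lemma fam_of_multiplicity A B m v (f : fcalg R A -> fcalg R B) :
  @fam_of A B m v f -> multiplicity f m.
Proof.
move=> [iv vf]; exists (famhom v); split; first by split=> //; exact: famhom_star_hom.
exists (famcol v); split=> [k l|x]; [exact: famcol_orth | exact: famhom_colE].
Qed.

Lemma fam_of_star_extendible A B m v (f : fcalg R A -> fcalg R B) : (0 < m)%N ->
  @fam_of A B m v f -> star_extendible f.
Proof.
move=> m0 vf; have [iv ef] := vf; split; last first.
  by exists (famhom v); split=> //; exact: famhom_star_hom.
split=> [c a a'|a a'|a a' e]; apply: fcval_inj; rewrite /=.
- by rewrite ef famhom_is_linear -!ef.
- by rewrite ef fcvalM famhomM // -!ef.
by apply: (famhom_inj m0 iv); rewrite -!ef e.
Qed.

(** Rigidity together with nondegeneracy, expressed through a multiplicity space so that it passes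
    to composites by tensoring. *)
Definition rigid_nondeg (o : bool) A B (f : fcalg R A -> fcalg R B) :=
  exists m v u w, [/\ @fam_of A B m v f, symfam (@blockidx A) (@blockidx B) v u w,
                      u *m w = w *m u & nondeg o u w].

Lemma rigid_nondeg_comp o A B D (f : fcalg R A -> fcalg R B)
    (g : fcalg R B -> fcalg R D) :
  rigid_nondeg o f -> rigid_nondeg o g -> rigid_nondeg o (g \o f).
Proof.
move=> [m [v [u [w [vf sv uw nv]]]]] [m' [v' [u' [w' [vg sv' uw' nv']]]]].
exists (m * m')%N, (fun x => famcomp (v x) v'), (u *t u'), (w *t w').
split; [exact: (fam_of_comp vf vg) | exact: (symfam_comp sv sv') | |
        exact: (nondeg_tens nv nv')].
by rewrite !mxtens.tensmx_mul uw uw'.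
Qed.

Lemma rigid_nondeg_id o A : rigid_nondeg o (@id (fcalg R A)).
Proof.
exists 1%N, (fun x => delta_mx x 0), 1%:M, 1%:M.
have di (x y : 'I_(\sum_(i < 4) bsize A i)) :
    (delta_mx x 0 : 'cV[R[i]]_(\sum_(i < 4) bsize A i)) *m
      (delta_mx y 0) ^t* = delta_mx x y.
  by rewrite trmx_delta map_delta_mx mul_delta_mx.
have iv : isofam (fun x => delta_mx x 0 : 'cV[R[i]]_(\sum_(i < 4) bsize A i)).
  move=> x y; rewrite trmx_delta map_delta_mx; case: eqVneq => [->|nxy].
    by rewrite mul_delta_mx; apply/matrixP => i j; rewrite !ord1 !mxE.
  by rewrite mul_delta_mx_0 // raddf0.
split=> //.
- split=> // a; rewrite {1}(matrix_sum_delta (fcval a)).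
  by apply: eq_bigr => x _; apply: eq_bigr => y _; rewrite di.
- split=> // [x z k|x].
    by rewrite mxE; have [->|] := eqVneq z x; rewrite ?eqxx.
  rewrite if_same mulmx1; apply/matrixP => z k; rewrite diagfun_mulE !mxE /=.
  by have [->|_] := eqVneq z x; rewrite ?mulr0.
by case: o; rewrite /nondeg // mulmx1 mxtrace1 oner_eq0.
Qed.

Lemma factor_rigid_nondeg o A B D (f : fcalg R A -> fcalg R B)
    (g : fcalg R B -> fcalg R D) :
  star_extendible f -> star_extendible g -> rigid_nondeg o (g \o f) ->
  exists m v u w, [/\ @fam_of A B m v f, symfam (@blockidx A) (@blockidx B) v u w &
                      u *m w = w *m u].
Proof.
move=> /star_extendible_fam [m [v vf]] /star_extendible_fam [q [w wg]].
move=> [m' [v' [u' [w' [vgf sv uw nd]]]]].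
have vwgf := fam_of_comp vf wg; have [x0 _] := blockidx_surj A 0.
(* The family witnessing rigidity of the composite is carried by a unitary to the tensor family
   built from [f] and [g]. *)
have [U [W [sT UW nD]]] := symfam_change x0 sv uw nd vwgf.1 (fam_of_eq vgf vwgf).
have q0 : (0 < q)%N by have := nondeg_gt0 nD; rewrite muln_gt0 => /andP [].
have [_ ct _] := sT; have [iv _] := vf; have [iw _] := wg.
have bv := fam_of_block vf; have bw := fam_of_block wg.
have cv := factor_upper iv bv iw bw q0 (@blockidx_surj A) ct.
have [a [a' [sa ca]]] :=
  factor_symfam iv bv iw bw (@blockidx_surj A) (@blockidx_surj B) sT cv UW nD.
by exists m, v, a, a'.
Qed.

(** In a basis diagonalizing u and w, each basis vector k has one sign per side. Side and sign of an
    index x then determine the block reached by the k-th column, so each column is by itself a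
    multiplicity one map between the algebras. *)
Lemma symfam_regular A B m v u w (f : fcalg R A -> fcalg R B) :
  star_extendible f -> @fam_of A B m v f -> symfam (@blockidx A) (@blockidx B) v u w ->
  u *m w = w *m u -> regular f.
Proof.
move=> sf [_ vf] sv uw; split=> //.
have [v' [e [e' [[iv cv jv] ev]]]] := symfam_diag (@blockidx_surj A) sv uw.
have bv x y k : v' x y k != 0 ->
    sgn R[i] (blockidx y) =
    sgn R[i] (blockidx x) * (if upper (blockidx x) then e k else e' k).
  move=> nz; have /matrixP/(_ y k) := jv x; rewrite diagfun_mulE [RHS]mxE /=.
  by case: ifP => _; rewrite mul_diagfunE mulrCA mulrC => /(mulfI nz) ->; rewrite mulrC.
have supp k a : famcol v' k *m fcval a *m (famcol v' k) ^t* \in fcpred R B.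
  apply/fcpred_entryP => z t nzt; apply/eqP; apply: contraNT nzt.
  move=> /mulmx_neq0 [y [/mulmx_neq0 [x [nx nxy]] ny]].
  rewrite mxE in nx; rewrite adjmxE conjC_eq0 mxE in ny.
  have sxy : fcsupp (blockidx x) (blockidx y).
    by apply: contraNT nxy => nxy; rewrite (fcpred_entryP _ (valP a)).
  have /predU1P [bxy|/andP [ux uy]] := sxy.
    suff -> : blockidx z = blockidx t by exact: fcsuppxx.
    apply: (block_eq (C := R[i])); first by rewrite (cv _ _ _ nx) (cv _ _ _ ny) bxy.
    by rewrite (bv _ _ _ nx) (bv _ _ _ ny) bxy.
  apply: fcsupp_upper; first by rewrite (cv _ _ _ nx).
  by rewrite (cv _ _ _ ny) /upper -leqNgt.
pose psi k a : fcalg R B := FCAlg (supp k a).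
have psif k : fam_of (fun x => \col_z v' x z k) (psi k).
  split=> [x y|a].
    apply/matrixP => i j; rewrite !ord1 mxE.
    have /matrixP/(_ k k) := iv x y; rewrite !mxE !eqxx => <-.
    by apply: eq_bigr => z _; rewrite !mxE.
  rewrite famhom_colE big_ord1 /=.
  have -> : famcol (fun x => \col_z v' x z k) ord0 = famcol v' k.
    by apply/matrixP => z x; rewrite !mxE.
  by [].
exists m, psi; split=> [k|].
  split; first exact: fam_of_star_extendible (psif k).
  exact: fam_of_multiplicity (psif k).
split=> [k l a b nkl|a]; apply: fcval_inj.
  rewrite fcvalM /= -!mulmxA (mulmxA _ (famcol v' l)) famcol_orth // (negPf nkl).
  by rewrite raddf0 mul0mx !mulmx0.
by rewrite fcval_sum vf ev famhom_colE.
Qed.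

Lemma factor_regular o A B D (f : fcalg R A -> fcalg R B)
    (g : fcalg R B -> fcalg R D) :
  star_extendible f -> star_extendible g -> rigid_nondeg o (g \o f) -> regular f.
Proof.
move=> sf sg /(factor_rigid_nondeg sf sg) [m [v [u [w [vf sv uw]]]]].
exact: symfam_regular vf sv uw.
Qed.

(** Each summand is conjugation by one isometry V_k. These are the columns of the family, and the
    signs of theta k at the blocks 1 and 3 are the diagonal entries of the symmetries. *)
Lemma rigid_sum_symfam A B N (theta : 'I_N -> 'S_4) psi (f : fcalg R A -> fcalg R B) :
  rigid_sum theta psi f ->
  exists v : _ -> 'M_(_, N), fam_of v f /\
    symfam (@blockidx A) (@blockidx B) v (diagfun_mx (fun k => sgn R[i] (theta k 0)))
                             (diagfun_mx (fun k => sgn R[i] (theta k 2%:R))).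
Proof.
move=> [rg [og ef]].
have ex k : exists V : 'M[R[i]]_(\sum_(i < 4) bsize B i, \sum_(i < 4) bsize A i),
    V ^t* *m V = 1%:M /\ forall a, fcval (psi k a) = V *m fcval a *m V ^t*.
  have [[_ [F [[_ eF] [V [oV FV]]]]] _ _] := rg k.
  exists (V 0); split; first by rewrite oV eqxx.
  by move=> a; rewrite -eF FV big_ord1.
have [V hV] := choice ex.
pose v x : 'M[R[i]]_(\sum_(i < 4) bsize B i, N) := \matrix_(z, k) V k z x.
have vV k : famcol v k = V k by apply/matrixP => z x; rewrite !mxE.
have iv : isofam v.
  apply: isofam_col => k l; rewrite !vV; case: eqVneq => [->|nkl].
    exact: (hV l).1.
  (* At the unit, psi_k takes the value V_k V_k^*, so orthogonality of the summands makes the ranges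
     orthogonal. *)
  have := congr1 (@fcval R B) (og k l 1 1 nkl).
  rewrite fcvalM !(hV _).2 fcval1 fcval0 !mulmx1 => h.
  have := congr1 (fun M => (V k) ^t* *m M *m V l) h.
  rewrite /= mulmx0 mul0mx -!mulmxA (hV l).1 mulmx1.
  by rewrite (mulmxA _ (V k)) (hV k).1 mul1mx => ->; rewrite raddf0.
(* Rigidity applied to the block projection Q_i shows that V_k Q_i has its range in that of
   Q'_theta(i). *)
have tV k z x : V k z x != 0 -> blockidx z = theta k (blockidx x).
  have [_ _ /(_ (blockidx x) (blockidx x) 1) [b eb]] := rg k.
  move=> nz; apply: contrapT => /eqP nbl; case/negP: nz; apply/eqP.
  have := congr1 (fun M => (fcval M *m V k) z x) eb.
  rewrite (hV k).2 !fcvalM fcval1 mulmx1 -!mulmxA (hV k).1 mulmx1 !fcval_blockproj.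
  by rewrite [V k *m (_ *m _)]mulmxA !mul_diagfunE !eqxx !mulr1 diagfun_mulE
             (negPf nbl) mul0r.
exists v; split.
  split=> // a; rewrite ef fcval_sum famhom_colE; apply: eq_bigr => k _.
  by rewrite vV (hV k).2.
split=> // [x z k|x].
  by rewrite mxE => /tV ->; have [_ ft _] := rg k; exact: ft.
apply/matrixP => z k; rewrite diagfun_mulE [RHS]mxE /=.
have -> : (v x *m (if upper (blockidx x)
                   then diagfun_mx (fun k => sgn R[i] (theta k 0))
                   else diagfun_mx (fun k => sgn R[i] (theta k 2%:R)))) z k =
    v x z k * (if upper (blockidx x)
               then sgn R[i] (theta k 0) else sgn R[i] (theta k 2%:R)).
  by case: ifP => _; rewrite mul_diagfunE.
have [->|] := eqVneq (v x z k) 0; first by rewrite !mul0r !mulr0.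
rewrite mxE => /tV ->; have [_ ft _] := rg k; rewrite (fctype_sgn _ _ ft).
by rewrite mulrCA mulrC mulrA.
Qed.

Lemma diagfun_comm n (e f : 'I_n -> R[i]) :
  diagfun_mx e *m diagfun_mx f = diagfun_mx f *m diagfun_mx e.
Proof.
apply/matrixP => i j; rewrite !diagfun_mulE !mxE.
by case: eqVneq => [->|_]; rewrite ?mulr0n ?mulr0 // mulrC.
Qed.

Lemma generic_odd_multiplicity A B (f : fcalg R A -> fcalg R B) : generic f ->
  ~ (exists m, multiplicity f m /\ ~~ odd m) -> rigid_nondeg true f.
Proof.
move=> [_ [N [theta [psi [rs _]]]]] nm; have [v [vf sv]] := rigid_sum_symfam rs.
exists N, v; do 2!eexists; split; [exact: vf | exact: sv | exact: diagfun_comm |].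
rewrite /nondeg; apply: contrapT => /negP oN; apply: nm; exists N.
by split; first exact: (fam_of_multiplicity vf).
Qed.

Lemma generic_H1_neq0 A B (f : fcalg R A -> fcalg R B) : generic f ->
  H1 f <> 0 -> rigid_nondeg false f.
Proof.
move=> [_ [N0 [theta0 [psi0 [rs0 _]]]]] nz.
(* The decomposition given by genericity shows that [H1_spec f] is inhabited, so [xget] returns a
   member and not its default 0. *)
have : H1_spec f (H1 f).
  apply: xgetPex; eexists; exists N0, theta0, psi0.
  by split; [exact: rs0 | reflexivity].
move=> [N [theta [psi [rs eH]]]]; have [v [vf sv]] := rigid_sum_symfam rs.
exists N, v; do 2!eexists; split; [exact: vf | exact: sv | exact: diagfun_comm |].
rewrite /nondeg.
suff -> : \tr (diagfun_mx (fun k => sgn R[i] (theta k 0)) *m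
               diagfun_mx (fun k => sgn R[i] (theta k 2%:R))) = (H1 f)%:~R :> R[i].
  by rewrite intr_eq0; apply/eqP.
have cE (P : pred 'I_N) : #|[set k | P k]|%:R = \sum_k (P k)%:R :> R[i].
  rewrite -sum1_card natr_sum big_mkcond; apply: eq_bigr => k _.
  by rewrite inE; case: (P k).
rewrite eH intrD intrN -!pmulrn !cE -sumrB /=.
apply: eq_bigr => k _; rewrite diagfun_mulE !mxE eqxx mulr1n.
by have [rg _] := rs; have [_ ft _] := rg k; exact: fctype_h1.
Qed.

End FourCycle.

(** * Direct systems *)

Section Systems.
Variable R : realType.
Implicit Type S : fcsystem R.

Lemma rigid_nondeg_siter o S k n :
  (forall i, (k <= i)%N -> rigid_nondeg o (@smap R S i)) ->
  rigid_nondeg o (@siter R S k n).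
Proof.
move=> h; elim: n => [|n IHn]; first exact: rigid_nondeg_id.
exact: rigid_nondeg_comp IHn (h _ (leq_addl n k)).
Qed.

Lemma rigid_nondeg_strans o S k l (kl : (k <= l)%N) :
  (forall i, (k <= i)%N -> rigid_nondeg o (@smap R S i)) ->
  rigid_nondeg o (strans (S := S) kl).
Proof.
move=> h; rewrite /strans; move: (subnK kl) => /=; move: (l - k)%N => n e.
by case: l / e {kl}; apply: rigid_nondeg_siter.
Qed.

Lemma strans_id S k (kk : (k <= k)%N) a : strans (S := S) kk a = a.
Proof.
rewrite /strans; move: (subnK kk); rewrite subnn => e.
by rewrite (eq_irrelevance e erefl).
Qed.

Lemma odd_system_rigid_nondeg S : generic_system S -> odd_system S ->
  exists K, forall i, (K <= i)%N -> rigid_nondeg true (@smap R S i).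
Proof.
move=> gS /finite_seqP [s es]; exists (\max_(i <- s) i).+1 => i Ki.
(* Beyond the largest of the finitely many indices with an even multiplicity, no map has one. *)
apply: generic_odd_multiplicity => // mi.
have : i \in s by move: mi; have := congr1 (fun A => A i) es => /= ->.
by move=> /(@leq_bigmax_seq _ s xpredT id i) /(_ isT) ile; move: Ki; rewrite ltnNge ile.
Qed.

(** A nonzero class is represented at some stage k; a map with zero H_1 action at any later stage i
    would send it to 0 at stage i + 1. *)
Lemma H1_nonzero_rigid_nondeg S : generic_system S -> H1_nonzero S ->
  exists K, forall i, (K <= i)%N -> rigid_nondeg false (@smap R S i).
Proof.
move=> gS [x x0]; have [k [z [_ [ex _]]]] := dl_in2 x x.
exists k => i ki; apply: generic_H1_neq0 => // di; apply: x0.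
rewrite ex -(@dl_in_push _ (k, z) i.+1) ?leqW // /push /= big_nat_recr //= di.
by rewrite !mulr0 dl_zeroE.
Qed.

End Systems.

(** * Regularity of the crossover maps from some index on *)

Theorem theorem4p1 :
  forall (R : realType) (S S' : fcsystem R),
    generic_system S -> generic_system S' ->
    (odd_system S /\ odd_system S') \/ (H1_nonzero S /\ H1_nonzero S') ->
    forall D : star_iso S S', regular_iso D.
Proof.
move=> R S S' gS gS' hyp D.
have [o [K [gK gK']]] : exists o K,
    (forall i, (K <= i)%N -> rigid_nondeg o (@smap R S i)) /\
    (forall i, (K <= i)%N -> rigid_nondeg o (@smap R S' i)).
  have glue o : (exists K, forall i, (K <= i)%N -> rigid_nondeg o (@smap R S i)) ->
      (exists K, forall i, (K <= i)%N -> rigid_nondeg o (@smap R S' i)) ->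
      exists o K, (forall i, (K <= i)%N -> rigid_nondeg o (@smap R S i)) /\
                  (forall i, (K <= i)%N -> rigid_nondeg o (@smap R S' i)).
    move=> [K gK] [K' gK']; exists o, (maxn K K').
    by split=> i; rewrite geq_max => /andP [Ki K'i]; [apply: gK | apply: gK'].
  case: hyp => [[h h']|[h h']].
    by apply: (glue true); apply: odd_system_rigid_nondeg.
  by apply: (glue false); apply: H1_nonzero_rigid_nondeg.
(* Strictly increasing indices satisfy i <= f i, so the bound [K] on system indices also serves for
   positions in the diagram. *)
have homo_ge f : {homo f : i j / (i < j)%N} -> forall i, (i <= f i)%N.
  by move=> hf; elim=> // i IHi; apply: leq_ltn_trans IHi (hf _ _ _).
(* [up] at i is the first factor of [down \o up], a given embedding of the first system beyond [K];
   [down] is treated likewise in the second system. *)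
have reg_up i : (K <= i)%N -> regular (@up _ _ _ D i).
  move=> Ki; apply: (@factor_regular _ o _ _ _ _ (@Defs.down _ _ _ D i)).
  - exact: up_star.
  - exact: down_star.
  rewrite (_ : _ \o _ = strans (ltnW (@sidx_lt _ _ _ D _ _ (ltnSn i)))).
    apply: rigid_nondeg_strans => j ij; apply: gK; apply: leq_trans ij.
    exact: leq_trans Ki (homo_ge _ (@sidx_lt _ _ _ D) i).
  by apply: funext => a; exact: down_up.
have reg_down i : (K <= i)%N -> regular (@Defs.down _ _ _ D i).
  move=> Ki; apply: (@factor_regular _ o _ _ _ _ (@up _ _ _ D i.+1)).
  - exact: down_star.
  - exact: up_star.
  rewrite (_ : _ \o _ = strans (ltnW (@tidx_lt _ _ _ D _ _ (ltnSn i)))).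
    apply: rigid_nondeg_strans => j ij; apply: gK'; apply: leq_trans ij.
    exact: leq_trans Ki (homo_ge _ (@tidx_lt _ _ _ D) i).
  by apply: funext => a; exact: up_down.
(* The subdiagram drops the first K stages; its crossover maps are the original ones, since the
   inserted transition maps are identities. *)
exists (addn K), (addn K), (addn K), (fun=> leqnn _), (fun=> leqnn _).
split=> [k|k]; first by rewrite addnS.
split.
  rewrite (_ : cross_up _ = @up _ _ _ D (K + k)); first exact: reg_up (leq_addr _ _).
  by apply: funext => a; rewrite /cross_up strans_id.
rewrite (_ : cross_down _ = @Defs.down _ _ _ D (K + k)).
  exact: reg_down (leq_addr _ _).
by apply: funext => a; rewrite /cross_down strans_id.
Qed.
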